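(* Let $n\ge 1$, let $\lambda=(\lambda_1\ge\dots\ge\lambda_n\ge 0)$ be a partition, and let $w\in S_n$. Then $$\overline L_{w\lambda}(\mathbf z;\beta)=\sum_{S\in\operatorname{SSLT}(w\lambda)}\beta^{\operatorname{ex}(S)}\mathbf z^{\operatorname{wt}(S)},$$ where the sum is over all set-valued skyline tableaux of shape $w\lambda$.
   Context: **Lascoux atoms.** $\mathbf z=(z_1,\dots,z_n)$ and $\beta$ are indeterminates, $\mathbf z^\alpha=z_1^{\alpha_1}\cdots z_n^{\alpha_n}$, $s_i=(i\ i{+}1)$, and $s_i\mathbf z$ is $\mathbf z$ with $z_i,z_{i+1}$ interchanged. Put $$\varpi_i f(\mathbf z;\beta)=\frac{(z_i+\beta z_iz_{i+1})f(\mathbf z;\beta)-(z_{i+1}+\beta z_iz_{i+1})f(s_i\mathbf z;\beta)}{z_i-z_{i+1}},\qquad \overline\varpi_i=\varpi_i-1.$$ For a reduced expression $w=s_{i_1}\cdots s_{i_\ell}$ set $\overline\varpi_w=\overline\varpi_{i_1}\cdots\overline\varpi_{i_\ell}$ (well defined by the braid relations). The Lascoux atom is $\overline L_{w\lambda}(\mathbf z;\beta)=\overline\varpi_w\mathbf z^\lambda$. $S_n$ acts on $\mathbb Z^n$ by $(w\lambda)_i=\lambda_{w^{-1}(i)}$. **Set-valued skyline tableaux.** For $\alpha=w\lambda$, the skyline diagram of $\alpha$ consists of left-justified rows $1,\dots,n$ (numbered from top to bottom), with $\alpha_i$ boxes in row $i$. A set-valued skyline tableau of shape $\alpha$ is a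 filling of the boxes by finite nonempty sets of positive integers satisfying the conditions below. The largest entry in a box is its anchor; the other entries of the box are free. 1. No entry is repeated within a column. 2. Rows weakly decrease: if box $B$ is to the left of box $A$ in the same row, then $\min B\ge\max A$. 3. For every triple of boxes $A,B,C$ of one of the following two forms, the anchors $a,b,c$ of $A,B,C$ satisfy $c<a$ or $b<c$: - (i) $B$ is immediately left of $A$ in some row, $C$ is in the same column as $A$ in a lower row, and the upper row (containing $A,B$) is weakly longer than the row of $C$; - (ii) $B$ is immediately left of $A$ in some row, $C$ is in the same column as $B$ in a higher row, and the lower row (containing $A,B$) is strictly longer than the row of $C$. 4. Every free entry lies in the box with the least anchor in its column among those boxes (with anchor larger than the entry) in which it can be placed without violating condition 2. 5. The anchor of each box in the first column equals its row index. $\operatorname{SSLT}(\alpha)$ is the set of all such tableaux. $\operatorname{wt}(S)_i$ is the number of boxes of $S$ containing $i$, and $\operatorname{ex}(S)=\sum_{X\in S}(|X|-1)$.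
   Formalization: The atom of wλ is taken as ϖ̄_u z^λ for a shortest u with uλ = wλ (any reduced expression of u); with w itself the identity fails when w is not shortest, e.g. λ=(1,1), w=s_1, where ϖ̄_1(z_1z_2)=0 but the tableau sum is z_1z_2. *)

(* Defs.v *)
From HB Require Import structures.
From mathcomp Require Import all_boot all_order all_fingroup all_algebra.
From mathcomp Require Export mpoly.

Set Implicit Arguments.
Unset Strict Implicit.
Unset Printing Implicit Defensive.

Import GRing.Theory.

(* All indices are shifted by one: the variable z_i, the row i and the entry i
   (1 <= i <= n) are represented by the ordinal i - 1 : 'I_n, and the simple
   transposition s_i (1 <= i < n) by the ordinal i - 1 : 'I_n.-1. *)

Section SymmetricGroup.
Variable n : nat.
Implicit Types (i : 'I_n.-1) (w u : 'S_n) (s : seq 'I_n.-1).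

Lemma simple_hi_subproof i : i.+1 < n.
Proof. by rewrite -ltn_predRL ltn_ord. Qed.

Definition simple_lo i : 'I_n := Ordinal (ltnW (simple_hi_subproof i)).
Definition simple_hi i : 'I_n := Ordinal (simple_hi_subproof i).
Definition simple_refl i : 'S_n := tperm (simple_lo i) (simple_hi i).

(* In MathComp (u * v) x = v (u x), so that the composite of functions
   s_{i_1} o ... o s_{i_l} is the reversed product. *)
Definition perm_of_word s : 'S_n := foldr (fun i u => u * simple_refl i)%g 1%g s.

Lemma perm_of_word_cat s1 s2 :
  perm_of_word (s1 ++ s2) = (perm_of_word s2 * perm_of_word s1)%g.
Proof.
elim: s1 => [|i s1 IH] /=; first by rewrite mulg1.
by rewrite IH mulgA.
Qed.

Lemma tperm_of_word (k : nat) (a b : 'I_n) :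
  b = a + k :> nat -> exists s, perm_of_word s = tperm a b.
Proof.
elim: k a b => [|k IH] a b def_b.
  exists [::]; have -> : b = a by apply: val_inj; rewrite /= def_b addn0.
  by rewrite tperm1.
have ltk : a + k < n.-1 by rewrite ltn_predRL -addnS -def_b ltn_ord.
pose i := Ordinal ltk.
have hi_b : simple_hi i = b by apply: val_inj; rewrite /= def_b addnS.
have [s def_s] := IH a (simple_lo i) erefl.
case: (posnP k) => [k0|k_gt0].
  exists [:: i]; rewrite /= mul1g /simple_refl hi_b.
  by congr tperm; apply: val_inj; rewrite /= k0 addn0.
exists (i :: s ++ [:: i]); rewrite /= perm_of_word_cat def_s /= mul1g.
have -> : (simple_refl i * tperm a (simple_lo i) * simple_refl i)%g
        = (tperm a (simple_lo i) ^ simple_refl i)%g.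
  by rewrite /conjg tpermV mulgA.
rewrite tpermJ /simple_refl tpermL hi_b tpermD //.
- by rewrite -val_eqE /= -{2}[val a]addn0 eqn_add2l -lt0n.
- by rewrite -val_eqE /= def_b -{2}[val a]addn0 eqn_add2l.
Qed.

Lemma exists_word w : exists s, perm_of_word s = w.
Proof.
have [ts -> _] := prod_tpermP w.
elim: ts => [|[a b] ts [s def_s]]; first by exists [::]; rewrite big_nil.
rewrite big_cons /=.
have [r def_r] : exists r, perm_of_word r = tperm a b.
  case/orP: (leq_total a b) => le_ab.
    by apply: (tperm_of_word (k := b - a)); rewrite subnKC.
  by rewrite tpermC; apply: (tperm_of_word (k := a - b)); rewrite subnKC.
by exists (s ++ r); rewrite perm_of_word_cat def_s def_r.
Qed.

Lemma perm_length_subproof w :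
  exists l, [exists t : l.-tuple 'I_n.-1, perm_of_word t == w].
Proof.
have [s def_s] := exists_word w.
by exists (size s); apply/existsP; exists (in_tuple s); rewrite /= def_s.
Qed.

Definition perm_length w : nat := ex_minn (perm_length_subproof w).

Definition reduced_word w s : bool :=
  (perm_of_word s == w) && (size s == perm_length w).

(* The left action (w a)_i = a_{w^{-1}(i)}. *)
Definition perm_act w (a : 'X_{1..n}) : 'X_{1..n} :=
  [multinom a ((w^-1)%g i) | i < n].

Definition is_partition (a : 'X_{1..n}) : Prop :=
  forall i j : 'I_n, i <= j -> a j <= a i.

(* For a partition a with repeated parts several permutations u give the same
   composition u a, and varpi_bar_word vanishes on the monomial z^a unless u is
   the shortest of them; the atom of u a is defined through that one. *)
Definition min_length_rep (a : 'X_{1..n}) u : Prop :=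
  forall v, perm_act v a = perm_act u a -> perm_length u <= perm_length v.

End SymmetricGroup.

Section LascouxAtoms.
Local Open Scope ring_scope.
Variable n : nat.
Local Notation Zpoly := {mpoly {poly int}[n]}.
Implicit Types (f g : Zpoly) (i : 'I_n.-1) (s : seq 'I_n.-1).

(* Polynomials in z have coefficients in Z[beta]. *)
Definition beta : {poly int} := 'X.

Definition zlo i : Zpoly := 'X_(simple_lo i).
Definition zhi i : Zpoly := 'X_(simple_hi i).

Lemma msym_zlo i : msym (simple_refl i) (zlo i) = zhi i.
Proof.
rewrite /zlo /zhi msymX; congr mpolyX; apply/mnmP=> j.
rewrite mnmE !mnmE /simple_refl tpermV; congr (nat_of_bool _).
by rewrite -(inj_eq (@perm_inj _ (tperm (simple_lo i) (simple_hi i)))) tpermK tpermL.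
Qed.

Lemma msym_zhi i : msym (simple_refl i) (zhi i) = zlo i.
Proof. by rewrite -msym_zlo -msymMm tperm2 msym1m. Qed.

Lemma msym_diff_dvd i f :
  exists g, g * (zlo i - zhi i) = f - msym (simple_refl i) f.
Proof.
pose P f := exists g, g * (zlo i - zhi i) = f - msym (simple_refl i) f.
have P0 : P 0 by exists 0; rewrite mul0r msym0 subr0.
have P1 : P 1 by exists 0; rewrite mul0r msym1 subrr.
have PD f1 f2 : P f1 -> P f2 -> P (f1 + f2).
  case=> g1 e1 [g2 e2]; exists (g1 + g2).
  by rewrite mulrDl e1 e2 msymD opprD addrACA.
have PZ c f1 : P f1 -> P (c *: f1).
  case=> g1 e1; exists (c *: g1).
  by rewrite -scalerAl e1 scalerBr msymZ.
have PM f1 f2 : P f1 -> P f2 -> P (f1 * f2).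
  case=> g1 e1 [g2 e2]; exists (g1 * f2 + msym (simple_refl i) f1 * g2).
  rewrite mulrDl -mulrA [f2 * _]mulrC mulrA e1 -mulrA e2 msymM.
  by rewrite mulrBl mulrBr addrA subrK.
have PX j : P 'X_j.
  case: (eqVneq j (simple_lo i)) => [->|ne_lo].
    by exists 1; rewrite mul1r msym_zlo.
  case: (eqVneq j (simple_hi i)) => [->|ne_hi].
    by exists (-1); rewrite mulN1r opprB msym_zhi.
  exists 0; rewrite mul0r msymX; apply/esym/eqP; rewrite subr_eq0; apply/eqP.
  congr mpolyX; apply/mnmP=> k; rewrite !mnmE tpermV; congr (nat_of_bool _).
  rewrite -[X in X == tperm _ _ k](@tpermD _ (simple_lo i) (simple_hi i) j) 1?eq_sym //.
  by rewrite (inj_eq perm_inj).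
rewrite -/(P f); move: P P0 P1 PD PZ PM PX => P P0 P1 PD PZ PM PX.
apply: (mpolyind (P := P) P0) => c m p _ _ Pp; apply: (PD _ _ _ Pp); apply: PZ.
rewrite mpolyXE_id; elim/big_ind: _ => // j _.
by elim: (m j) => [|k IH]; [rewrite expr0 | rewrite exprS; apply: PM].
Qed.

Definition varpi_num i f : Zpoly :=
  (zlo i + beta *: (zlo i * zhi i)) * f
  - (zhi i + beta *: (zlo i * zhi i)) * msym (simple_refl i) f.

Lemma varpi_subproof i f : exists g, g * (zlo i - zhi i) == varpi_num i f.
Proof.
have [g e] := msym_diff_dvd i ((zlo i + beta *: (zlo i * zhi i)) * f).
exists g; rewrite e msymM msymD msymZ msymM msym_zlo msym_zhi.
by rewrite /varpi_num [zhi i * zlo i]mulrC.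
Qed.

(* The quotient of varpi_num i f by z_i - z_{i+1}. *)
Definition varpi i f : Zpoly := xchoose (varpi_subproof i f).

Lemma varpiP i f : varpi i f * (zlo i - zhi i) = varpi_num i f.
Proof. exact/eqP/(xchooseP (varpi_subproof i f)). Qed.

Definition varpi_bar i f : Zpoly := varpi i f - f.

Definition varpi_bar_word s f : Zpoly := foldr varpi_bar f s.

End LascouxAtoms.

Section Tableaux.
Variables (n : nat) (alpha : 'X_{1..n}).

Definition box : finType := {i : 'I_n & 'I_(alpha i)}.
Definition box_row (b : box) : 'I_n := tag b.
Definition box_col (b : box) : nat := tagged b.

(* Since rows weakly decrease and the anchor of a first-column box is its row
   index, no entry of a tableau exceeds n. *)
Definition filling : finType := {ffun box -> {set 'I_n}}.
Implicit Types (S : filling) (A B C D : box) (x : 'I_n).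

Definition nonempty_boxes S : bool := [forall A, S A != set0].

Definition anchor S A : nat := \max_(x in S A) x.

Definition columns_distinct S : bool :=
  [forall A, forall B,
    (box_col A == box_col B) && (A != B) ==> [disjoint S A & S B]].

Definition rows_decrease S : bool :=
  [forall B, forall A, (box_row B == box_row A) && (box_col B < box_col A) ==>
    [forall x in S B, forall y in S A, (y <= x)%N]].

Definition immediately_left B A : bool :=
  (box_row B == box_row A) && ((box_col B).+1 == box_col A).

Definition triple_i A B C : bool :=
  [&& immediately_left B A, box_col C == box_col A, box_row A < box_row C
    & alpha (box_row C) <= alpha (box_row A)].

Definition triple_ii A B C : bool :=
  [&& immediately_left B A, box_col C == box_col B, box_row C < box_row A
    & alpha (box_row C) < alpha (box_row A)].

Definition triple_condition S : bool :=
  [forall A, forall B, forall C, triple_i A B C || triple_ii A B C ==>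
    (anchor S C < anchor S A) || (anchor S B < anchor S C)].

Definition place S x D : filling :=
  [ffun A => if A == D then x |: S A else S A].

Definition free_entry S x A : bool := (x \in S A) && (x != anchor S A :> nat).

Definition can_hold S x D : bool :=
  (x < anchor S D) && rows_decrease (place S x D).

Definition free_entries_lowest S : bool :=
  [forall A, forall x, free_entry S x A ==>
    can_hold S x A &&
    [forall D, (box_col D == box_col A) && can_hold S x D ==>
       (anchor S A <= anchor S D)]].

Definition first_column_anchors S : bool :=
  [forall A, (box_col A == 0) ==> (anchor S A == box_row A)].

Definition SSLT : {set filling} :=
  [set S | [&& nonempty_boxes S, columns_distinct S, rows_decrease S,
               triple_condition S, free_entries_lowest S
             & first_column_anchors S]].

Definition wt S : 'X_{1..n} := [multinom #|[set A | i \in S A]| | i < n].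

Definition excess S : nat := \sum_(A : box) (#|S A| - 1).

End Tableaux.

(* Main.v *)
Require Import Defs.
From mathcomp Require Import all_boot all_order all_fingroup all_algebra.
From mathcomp Require Import zify ring.

(* The free entries of a tableau can be summed out: position x of a column C_j
   contributes z_x if x is an anchor, 1 + beta z_x if some row r has
   a_{j+1}(r) <= x < a_j(r), and 1 otherwise.  The triple conditions then say
   that the anchors evolve from column to column by a greedy rule in which the
   upper of two competing rows wins.  This is a solvable vertex model: the rows
   are colours, the state of a column is a word position -> colour, and the
   transfer to the next column scans the positions downwards.

   - For colours a < c at positions i, i+1 the partition function F satisfies
     F(c,a) = varpi_i F(a,c); exchanging two positions commutes with a single
     column transfer, whence the general case.
   - The dynamics is blind to the difference between two adjacent colours, so if
     alpha_i > alpha_{i+1} then F(id; alpha) + F(id; s_i alpha) is equal to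
     F(s_i; alpha) + F(s_i; s_i alpha), and the last term vanishes because a
     flipped pair never separates in the wrong order.
   Hence F(id; s_i alpha) = (varpi_i - 1) F(id; alpha), which is the recursion
   for atoms; for a partition the only tableau has all entries of row r equal
   to r. *)

Set Implicit Arguments.
Unset Strict Implicit.
Unset Printing Implicit Defensive.

Import GRing.Theory.

(** * A single column of the vertex model and the exchange relation *)

Section Transfer.
Local Open Scope ring_scope.
Variables (n : nat) (R : comNzRingType) (b : R).
Local Notation color := 'I_n.
Local Notation word := (seq (option color)).
Implicit Types (a c d : color) (x y : option color) (B : seq color) (v w : word).
Implicit Types (z : R) (zs : seq R) (K : word -> seq color -> R).

Definition leo : rel color := fun a c => (a <= c)%N.

Fixpoint ins a B : seq color :=
  if B is c :: B' then if leo a c then a :: B else c :: ins a B' else [:: a].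

Definition inso x B := if x is Some a then ins a B else B.

(* One vertex: [B] is the sorted list of the colours met at higher positions and
   not yet emitted, [w] the part of the next column built so far, and [K] the
   continuation.  The head of a word is its lowest position, hence comes last. *)
Definition vweight z x B : R :=
  if x is Some _ then z else if B is [::] then 1 else 1 + b * z.

Definition emit K w B : R :=
  K (None :: w) B + (if B is a :: B' then K (Some a :: w) B' else 0).

Lemma emit_cons K w a B :
  emit K w (a :: B) = K (None :: w) (a :: B) + K (Some a :: w) B.
Proof. by []. Qed.

Definition step z x K w B : R := vweight z x B * emit K w (inso x B).

Fixpoint steps zs v K : word -> seq color -> R :=
  match zs, v with
  | z :: zs', x :: v' => steps zs' v' (step z x K)
  | _, _ => K
  end.

Lemma steps_cat zs1 zs2 v1 v2 K :
  size zs1 = size v1 ->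
  steps (zs1 ++ zs2) (v1 ++ v2) K = steps zs2 v2 (steps zs1 v1 K).
Proof. by elim: zs1 v1 K => [|z zs1 IH] [|x v1] K //= [/IH->]. Qed.

Lemma leo_total : total leo. Proof. by move=> a c; apply: leq_total. Qed.
Lemma leo_trans : transitive leo. Proof. by move=> a c d; apply: leq_trans. Qed.

Lemma ins_path d a B : leo d a -> path leo d B -> path leo d (ins a B).
Proof.
elim: B d => [|c B IH] d /= da; first by rewrite da.
case/andP=> dc pB; case: ifP => ac /=; first by rewrite da ac pB.
by rewrite dc IH //; case/orP: (leo_total a c); rewrite ?ac.
Qed.

Lemma ins_sorted a B : sorted leo B -> sorted leo (ins a B).
Proof.
case: B => [|c B] //= pB; case: ifP => ac /=; first by rewrite ac.
by apply: ins_path => //; case/orP: (leo_total a c); rewrite ?ac.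
Qed.

Lemma inso_sorted x B : sorted leo B -> sorted leo (inso x B).
Proof. by case: x => //= a; apply: ins_sorted. Qed.

Lemma perm_ins a B : perm_eq (ins a B) (a :: B).
Proof.
elim: B => [|c B IH] //=; case: ifP => // _.
apply: (perm_trans (y := [:: c, a & B])); first by rewrite perm_cons.
by rewrite (perm_catCA [:: c] [:: a]).
Qed.

Lemma ins_head a B : path leo a B -> ins a B = a :: B.
Proof. by case: B => [|c B] //= /andP[->]. Qed.

Lemma ins_tail u c B : path leo u B -> leo u c -> ins c (u :: B) = u :: ins c B.
Proof.
move=> uB uc /=; case: ifP => // cu.
have -> : c = u by apply/val_inj/eqP; rewrite eqn_leq; apply/andP.
by rewrite ins_head.
Qed.

Lemma ins_consP a B : exists u B', ins a B = u :: B'.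
Proof. by case: B => [|c B] /=; [|case: ifP => _]; do 2 eexists. Qed.

Lemma ins_comm a c B : sorted leo B -> ins a (ins c B) = ins c (ins a B).
Proof.
move=> sB; apply: (sorted_eq leo_trans); do ?exact/ins_sorted/ins_sorted.
- by move=> d e /andP[de ed]; apply/val_inj/eqP; rewrite eqn_leq; apply/andP.
apply: (perm_trans (perm_ins _ _)).
apply: (perm_trans (y := [:: a, c & B])); first by rewrite perm_cons perm_ins.
rewrite perm_sym; apply: (perm_trans (perm_ins _ _)).
apply: (perm_trans (y := [:: c, a & B])); first by rewrite perm_cons perm_ins.
by rewrite (perm_catCA [:: c] [:: a]).
Qed.

(** * Exchange of two adjacent positions *)

Section Exchange.
Variables (s : {rmorphism R -> R}) (p q : R).
Hypotheses (sp : s p = q) (sq : s q = p) (sb : s b = b).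

(* [f x y] is the value of the model with colours x, y at the positions of the
   variables p, q.  These are the solutions of [f (c, a) = varpi f (a, c)] and
   [f (None, a) = varpi_bar f (a, None)], written without denominators by means
   of symmetric t and u. *)
Definition exch (f : option color -> option color -> R) : Prop :=
  [/\ s (f None None) = f None None,
      forall a, exists t u, [/\ s t = t, s u = u, f (Some a) None = t + p * u
                              & f None (Some a) = q * (1 + b * p) * u]
    & forall a c, leo a c -> exists t u,
        [/\ s t = t, s u = u, f (Some c) (Some a) = t
          & f (Some a) (Some c) = t + q * (1 + b * p) * u]].

Lemma eq_exch f g : (forall x y, f x y = g x y) -> exch f -> exch g.
Proof.
move=> fg [f0 f1 f2]; split=> [|a|a c /f2]; rewrite -?fg //.
Qed.

Lemma exch0 : exch (fun _ _ => 0).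
Proof.
by split=> [|a|a c _]; rewrite ?rmorph0 //; exists 0, 0; rewrite !rmorph0 !mulr0 addr0.
Qed.

Lemma exchD f g : exch f -> exch g -> exch (fun x y => f x y + g x y).
Proof.
move=> [f0 f1 f2] [g0 g1 g2]; split=> [|a|a c ac].
- by rewrite rmorphD f0 g0.
- have [t [u [st su -> ->]]] := f1 a; have [t' [u' [st' su' -> ->]]] := g1 a.
  by exists (t + t'), (u + u'); rewrite !rmorphD st su st' su'; split=> //; ring.
have [t [u [st su -> ->]]] := f2 a c ac; have [t' [u' [st' su' -> ->]]] := g2 a c ac.
by exists (t + t'), (u + u'); rewrite !rmorphD st su st' su'; split=> //; ring.
Qed.

Lemma exchM k f : s k = k -> exch f -> exch (fun x y => k * f x y).
Proof.
move=> sk [f0 f1 f2]; split=> [|a|a c ac].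
- by rewrite rmorphM f0 sk.
- have [t [u [st su -> ->]]] := f1 a.
  by exists (k * t), (k * u); rewrite !rmorphM sk st su; split=> //; ring.
have [t [u [st su -> ->]]] := f2 a c ac.
by exists (k * t), (k * u); rewrite !rmorphM sk st su; split=> //; ring.
Qed.

(** Applied to the admissibility test, which sees only the set of colours of a word. *)
Lemma exch_if (P : option color -> option color -> bool) f :
  (forall x y, P x y = P y x) -> exch f -> exch (fun x y => if P x y then f x y else 0).
Proof.
move=> Psym [f0 f1 f2]; split=> [|a|a c ac].
- by case: ifP; rewrite ?rmorph0.
- rewrite (Psym None); case: ifP => _ //.
  by exists 0, 0; rewrite !rmorph0 !mulr0 addr0.
rewrite (Psym (Some c)); case: ifP => _; first exact: f2.
by exists 0, 0; rewrite !rmorph0 !mulr0 addr0.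
Qed.

(** In the notation of [exch] the sum is [t + (p + q + b * p * q) * u]. *)
Lemma exch_pair f a : exch f -> s (f None (Some a) + f (Some a) None) = f None (Some a) + f (Some a) None.
Proof.
case=> _ /(_ a) [t [u [st su -> ->]]] _.
by rewrite !(rmorphD, rmorphM, rmorph1) sp sq sb st su; ring.
Qed.

Lemma exch_desc f a c : exch f -> leo a c -> s (f (Some c) (Some a)) = f (Some c) (Some a).
Proof. by case=> _ _ f2 /f2[t [u [st _ -> _]]]. Qed.

(** Group the outcomes by the number of filled positions. One filled position is [exch_pair]. If
    both are filled, the smaller colour came out first, at the upper position, and [exch_desc]
    applies. *)
Lemma emit2_sym K w B : sorted leo B ->
  (forall B', exch (fun x y => K (x :: y :: w) B')) ->
  s (emit (emit K) w B) = emit (emit K) w B.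
Proof.
move=> sB exK; rewrite /emit.
case: B sB => [|a [|c B]] /= sB; rewrite ?addr0.
- by have [->] := exK [::].
- have [e _ _] := exK [:: a]; have e1 := exch_pair a (exK [::]).
  rewrite -addrA [K (Some a :: _) _ + _]addrC rmorphD e; congr (_ + _).
  exact: e1.
case/andP: sB => ac _.
have [e _ _] := exK [:: a, c & B]; have e1 := exch_pair a (exK (c :: B)).
have e2 := exch_desc (exK B) ac.
rewrite -addrA [K (Some a :: _) _ + _]addrA [K (Some a :: _) _ + _]addrC 2!rmorphD.
by rewrite e e1 e2.
Qed.

(** Measures the error made when the upper position receives the larger colour c while a stays in
    the carry. It has the very shape that [exch] tolerates. *)
Lemma emit_swap K w a c B : leo a c ->
  (forall B', exch (fun x y => K (x :: y :: w) B')) ->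
  exists2 t, s t = t & emit K (Some c :: w) (a :: B)
                     = emit K (Some a :: w) (c :: B) + q * (1 + b * p) * t.
Proof.
move=> ac exK; rewrite /emit.
have [_ e1 _] := exK (a :: B); have [t1 [u1 [st1 su1 _ ->]]] := e1 c.
have [_ e2 _] := exK (c :: B); have [t2 [u2 [st2 su2 _ ->]]] := e2 a.
have [_ _ e3] := exK B; have [t3 [u3 [st3 su3 -> ->]]] := e3 a c ac.
exists (u1 - u2 + u3); last by ring.
by rewrite !rmorphD rmorphN su1 su2 su3.
Qed.

(** Up to weights, the value is the symmetric [emit (emit K)] of the carry with all incoming colours
    inserted, as long as the lower colour does not precede the one emitted above it. If it does,
    [emit_swap] gives the correction. Carries too short to stay nonempty between the two positions
    are expanded by hand. *)
Lemma exch_step2 K w B : sorted leo B ->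
  (forall B', exch (fun x y => K (x :: y :: w) B')) ->
  exch (fun x y => step q y (step p x K) w B).
Proof.
move=> sB exK; split=> [|a|a c ac].
- case: B sB => [|a [|c B]] sB; rewrite /step /= ?(mul1r, mulr1).
  + by rewrite /emit /= !mul1r !addr0; have [->] := exK [::].
  (* If the only carried colour leaves at the upper position, the lower weight is 1 instead of
     [1 + b * p]. *)
  + rewrite /emit /= !mul1r !addr0.
    have [e e1 _] := exK [:: a]; have [_ e2 _] := exK [::].
    have [t [u [st su -> ->]]] := e2 a.
    rewrite !(rmorphM, rmorphD, rmorph1) e st su sp sq sb; ring.
  have -> f : emit (fun w B => vweight p None B * emit K w (inso None B)) f [:: a, c & B]
     = (1 + b * p) * emit (emit K) f [:: a, c & B].
    by rewrite emit_cons [in RHS]emit_cons /=; ring.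
  rewrite !rmorphM emit2_sym // !(rmorphM, rmorphD, rmorph1) sp sq sb; ring.
- case: B sB => [|c B] sB; rewrite /step /= ?(mul1r, mulr1).
    rewrite /emit /= !mul1r !addr0.
    have [e _ _] := exK [:: a]; have [_ e2 _] := exK [::].
    have [t [u [st su -> ->]]] := e2 a.
    (* The value at [(None, Some a)] dictates the second witness; the first is what remains of the
       value at [(Some a, None)]. *)
    exists (- (p * q * u)), (K [:: None, None & w] [:: a] + t + (p + q) * u).
    rewrite !(rmorphM, rmorphD, rmorphN, rmorph1) e st su sp sq.
    by split; ring.
  set W := ins a (c :: B); set Y := emit (emit K) w W.
  have sY : s Y = Y by apply: emit2_sym => //; apply: ins_sorted.
  have -> : emit (fun w B => vweight p None B * emit K w (inso None B)) w W = (1 + b * p) * Y.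
    have [d [e [V eW]]] : exists d e V, W = [:: d, e & V].
      rewrite /W /=; case: ifP => _; first by do 3 eexists.
      by have [u [V ->]] := ins_consP a B; do 3 eexists.
    by rewrite /Y eW emit_cons [in RHS]emit_cons /=; ring.
  (* With a at the lower position, the upper emission sees only the head c. A correction is needed
     only if a precedes c. *)
  have [t st ->] : exists2 t, s t = t &
      emit (fun w B => vweight p (Some a) B * emit K w (inso (Some a) B)) w (c :: B)
       = p * (Y + q * (1 + b * p) * t).
    rewrite emit_cons /= -/(ins a (c :: B)) -/W -mulrDr /Y /W /=.
    case: ifP => ac; last first.
      by exists 0; rewrite ?rmorph0 // mulr0 addr0.
    rewrite ins_head; last by case: B sB {sY W Y} => //= d B /andP[cd ->]; rewrite (leo_trans ac cd).
    have [t st e] := emit_swap B ac exK; exists t => //.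
    by rewrite [emit (emit K) _ _]emit_cons e addrA.
  exists (b * p * q * Y + p * q * (1 + b * p) * (1 + b * q) * t), Y.
  rewrite !(sY, rmorphM, rmorphD, rmorphN, rmorph1) st sp sq sb.
  by split=> //; ring.
set W := ins c (ins a B); set Y := emit (emit K) w W.
have sY : s Y = Y by apply: emit2_sym => //; do 2 apply: ins_sorted.
(* When the head u is at most c', the later insertion of c' does not alter the upper emission. *)
have e1 a' c' u U : ins a' B = u :: U -> leo u c' ->
    step q (Some a') (step p (Some c') K) w B = p * q * emit (emit K) w (ins c' (ins a' B)).
  move=> e uc'; rewrite /step /= e ins_tail //; last by move: (ins_sorted a' sB); rewrite e.
  rewrite emit_cons /= -/(ins c' (u :: U)) ins_tail //; first by rewrite [in RHS]emit_cons; ring.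
  by move: (ins_sorted a' sB); rewrite e.
have [u [U eU]] := ins_consP a B.
have [v [V eV]] := ins_consP c B.
have ua : leo u a.
  case: (B) eU => [|d B'] /=; first by move=> [<- _]; apply: leqnn.
  case: ifP => ad [<- _]; first exact: leqnn.
  by case/orP: (leo_total a d) => //; rewrite ad.
rewrite (e1 _ _ _ _ eU (leo_trans ua ac)) -/W -/Y.
exists (p * q * Y).
case: (boolP (leo v a)) => va.
  rewrite (e1 _ _ _ _ eV va) ins_comm // -/W -/Y.
  exists 0; rewrite !(sY, rmorphM, rmorph0) sp sq; split=> //; ring.
(* Remaining case: the upper position can emit v although the smaller colour a arrives just
   below. *)
have av : leo a v by case/orP: (leo_total a v) => // /(negP va).
have pvV : path leo v V by move: (ins_sorted c sB); rewrite eV.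
have [t st e] := emit_swap V av exK.
exists (p * q * t); rewrite !(sY, rmorphM) sp sq st; split=> //; try ring.
rewrite /Y /W -ins_comm // eV /= av /step /= eV emit_cons /= av [emit (emit K) _ _]emit_cons ins_head; last first.
  by case: (V) pvV => //= d V' /andP[vd ->]; rewrite (leo_trans av vd).
rewrite e; ring.
Qed.

(** Positions below the pair are scanned after it, and their weights are fixed by [s]. *)
Lemma exch_steps_low zs v K w B :
  (forall z, z \in zs -> s z = z) ->
  (forall w2 B, size w2 = minn (size zs) (size v) ->
     exch (fun x y => K (w2 ++ x :: y :: w) B)) ->
  exch (fun x y => steps zs v K (x :: y :: w) B).
Proof.
elim: zs v K B => [|z zs IH] [|x0 v] K B fix_zs exK /=; try exact: (exK [::]).
apply: IH => [z' z'in|w2 B' sz_w2]; first by rewrite fix_zs // inE z'in orbT.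
rewrite /step /emit; apply: exchM.
  case: (x0) => [_|] /=; first by rewrite fix_zs ?mem_head.
  by case: B' => [|_ _]; rewrite ?rmorphD ?rmorphM ?rmorph1 // sb fix_zs ?mem_head.
apply: exchD; first by apply: (exK (None :: w2)); rewrite /= sz_w2 minnSS.
case: inso => [|a B2]; first exact: exch0.
by apply: (exK (Some a :: w2)); rewrite /= sz_w2 minnSS.
Qed.

Lemma exch_steps_high zs v (K : option color -> option color -> word -> seq color -> R) w B :
  (forall z, z \in zs -> s z = z) -> sorted leo B ->
  (forall w B, sorted leo B -> exch (fun x y => K x y w B)) ->
  exch (fun x y => steps zs v (K x y) w B).
Proof.
elim: zs v K w B => [|z zs IH] [|x0 v] K w B fix_zs sB exK /=; try exact: exK.
apply: IH => // [z' z'in|w' B' sB']; first by rewrite fix_zs // inE z'in orbT.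
rewrite /step /emit; apply: exchM.
  case: (x0) => [_|] /=; first by rewrite fix_zs ?mem_head.
  by case: B' {sB'} => [|_ _]; rewrite ?rmorphD ?rmorphM ?rmorph1 // sb fix_zs ?mem_head.
have := inso_sorted x0 sB'; case: inso => [|a B2] sB2; apply: exchD; try exact: exK.
  exact: exch0.
by apply: exK; apply: path_sorted sB2.
Qed.

Lemma exch_steps zs1 zs2 v1 v2 K w B :
  (forall z, z \in zs1 -> s z = z) -> (forall z, z \in zs2 -> s z = z) ->
  size zs1 = size v1 -> sorted leo B ->
  (forall w1 w2 B, size w1 = size v1 -> exch (fun x y => K (w1 ++ x :: y :: w2) B)) ->
  exch (fun x y => steps (zs1 ++ p :: q :: zs2) (v1 ++ x :: y :: v2) K w B).
Proof.
move=> fix1 fix2 sz sB exK.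
apply: (@eq_exch (fun x y => steps zs2 v2 (step q y (step p x (steps zs1 v1 K))) w B)).
  by move=> x y; rewrite steps_cat.
apply: exch_steps_high => // w' B' sB'; apply: exch_step2 => // B2.
apply: exch_steps_low => // w2 B3; rewrite sz minnn => sz2.
exact: exK.
Qed.

End Exchange.
End Transfer.

(** * Partition functions *)

Section Partition.
Local Open Scope ring_scope.
Variables (n : nat) (R : comNzRingType) (b : R).
Local Notation color := 'I_n.
Local Notation word := (seq (option color)).
Local Notation leo := (@leo n).
Implicit Types (a c d : color) (x y : option color) (B : seq color) (v w : word).
Implicit Types (z : R) (zs : seq R) (K : word -> seq color -> R).

Definition colors v : seq color := pmap id v.

Lemma mem_colors c v : (c \in colors v) = (Some c \in v).
Proof. by elim: v => [|[a|] v IH] //=; rewrite !inE IH //. Qed.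

Lemma colors_map (f : color -> color) v : colors (map (omap f) v) = map f (colors v).
Proof. by elim: v => [|[a|] v /= ->]. Qed.

(** A colour may stay behind in the carry only in the transfer where its row ends. *)
Definition admissible (al : color -> nat) j w B : bool :=
  all (fun c => al c == j) B && all (fun c => j < al c)%N (colors w).

Fixpoint pfun zs (al : color -> nat) j m v : R :=
  if m is m'.+1 then
    steps b zs v (fun w B => if admissible al j w B then pfun zs al j.+1 m' w else 0)
      [::] [::]
  else (colors v == [::])%:R.

(** Invariant of a scan: every colour met is either written or still carried. *)
Definition outcome v w B : Prop :=
  [/\ size w = size v, sorted leo B & perm_eq (colors w ++ B) (colors v)].

Lemma outcome_None x v w B :
  outcome v w B -> outcome (x :: v) (None :: w) (inso x B).
Proof.
case=> sw sB pB; split; rewrite /= ?sw ?inso_sorted //.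
case: x => [a|] //=; apply: (perm_trans (y := colors w ++ a :: B)).
  by rewrite perm_cat2l perm_ins.
by rewrite (perm_catCA _ [:: a]) /= perm_cons.
Qed.

Lemma outcome_Some a x v w B B' :
  outcome v w B -> inso x B = a :: B' -> outcome (x :: v) (Some a :: w) B'.
Proof.
move=> /(outcome_None x)[sw sB pB] ex; move: sB pB; rewrite ex /= => sB pB.
split; rewrite ?(path_sorted sB) //.
by apply: (perm_trans _ pB); rewrite /= perm_sym (perm_catCA _ [:: a]).
Qed.

(** * Invariance under weakly monotone recolourings *)

Section Parametricity.
Variable phi : color -> nat.
Hypothesis phi_mono : forall a c, leo a c -> (phi a <= phi c)%N.
Local Notation phiw := (map (omap phi)).

Lemma phi_inso x x' B B' : omap phi x = omap phi x' -> map phi B = map phi B' ->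
  sorted leo B -> sorted leo B' -> map phi (inso x B) = map phi (inso x' B').
Proof.
case: x x' => [a|] [a'|] //= [ea] eB sB sB'.
apply: (sorted_eq leq_trans anti_leq); try exact/(homo_sorted phi_mono)/ins_sorted.
apply: (perm_trans (perm_map phi (perm_ins a B))).
by rewrite perm_sym; apply: (perm_trans (perm_map phi (perm_ins a' B'))); rewrite /= ea eB.
Qed.

(* The minimum of the carry is preserved by weakly monotone recolourings, so two
   words with the same image have parallel evolutions. *)
Lemma steps_rel zs v v' K K' :
  size zs = size v -> phiw v = phiw v' ->
  (forall w w' B B', phiw w = phiw w' -> map phi B = map phi B' ->
     outcome v w B -> outcome v' w' B' -> K w B = K' w' B') ->
  steps b zs v K [::] [::] = steps b zs v' K' [::] [::].
Proof.
elim: zs v v' K K' => [|z zs IH] [|x v] [|x' v'] K K' //=; first by move=> _ _; apply.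
case=> sz [ex ev] eK; apply: IH => // w w' B B' ew eB oB oB'.
rewrite /step /emit; congr (_ * _).
  by case: x x' ex {eK} => [a|] [a'|] //= _; case: (B) (B') eB => [|? ?] [].
have [_ sB _] := oB; have [_ sB' _] := oB'.
have eI := phi_inso ex eB sB sB'.
congr (_ + _); first by apply: eK; rewrite /= ?ew //; apply: outcome_None.
case eC: (inso x B) eI => [|a C]; case eC': (inso x' B') => [|a' C'] //= [ea eCC'].
apply: eK => //=; first by rewrite ea ew.
  exact: outcome_Some eC.
exact: outcome_Some eC'.
Qed.

Lemma all_rel (f : color -> nat) (P P' : pred color) (s s' : seq color) : map f s = map f s' ->
  (forall k k', k \in s -> k' \in s' -> f k = f k' -> P k = P' k') -> all P s = all P' s'.
Proof.
elim: s s' => [|k s IH] [|k' s'] //= [ek es] H.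
rewrite (H k k') ?mem_head // (IH s') // => l l' ls ls'.
by apply: H; rewrite inE ?ls ?ls' orbT.
Qed.

Lemma phiw_colors v v' : phiw v = phiw v' -> map phi (colors v) = map phi (colors v').
Proof. by elim: v v' => [|[a|] v IH] [|[a'|] v'] //=; move=> []; do ?move=> ->; move/IH->. Qed.

(** Iterates [steps_rel] over the columns; the length functions enter only through the admissibility
    tests. *)
Lemma pfun_rel zs (al al' : color -> nat) j m v v' :
  size zs = size v -> phiw v = phiw v' ->
  (forall k k', k \in colors v -> k' \in colors v' -> phi k = phi k' -> al k = al' k') ->
  pfun zs al j m v = pfun zs al' j m v'.
Proof.
elim: m j v v' => [|m IH] j v v' sz ev H /=.
  congr (_%:R); congr (nat_of_bool _).
  by move/phiw_colors: ev; case: (colors v) (colors v') => [|? ?] [].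
apply: steps_rel => // w w' B B' ew eB [sw _ pB] [_ _ pB'].
have Hw k k' : k \in colors w -> k' \in colors w' -> phi k = phi k' -> al k = al' k'.
  by move=> kw kw'; apply: H; rewrite -?(perm_mem pB) -?(perm_mem pB') mem_cat ?kw ?kw'.
have HB k k' : k \in B -> k' \in B' -> phi k = phi k' -> al k = al' k'.
  by move=> kw kw'; apply: H; rewrite -?(perm_mem pB) -?(perm_mem pB') mem_cat ?kw ?kw' orbT.
have -> : admissible al j w B = admissible al' j w' B'.
  congr (_ && _); first by apply: (all_rel eB) => k k' kB kB' /(HB _ _ kB kB') ->.
  by apply: (all_rel (phiw_colors ew)) => k k' kw kw' /(Hw _ _ kw kw') ->.
by case: ifP => // _; apply: IH => //; rewrite sz sw.
Qed.

End Parametricity.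

Lemma eq_steps zs v K K' w B : (forall w B, K w B = K' w B) ->
  steps b zs v K w B = steps b zs v K' w B.
Proof.
elim: zs v K K' => [|z zs IH] [|x v] K K' //= eK; apply: IH => w' B'.
by rewrite /step /emit eK; case: inso => // a C; rewrite eK.
Qed.

Lemma eq_pfun zs (al al' : color -> nat) j m v : al =1 al' -> size zs = size v ->
  pfun zs al j m v = pfun zs al' j m v.
Proof.
move=> e sz; apply: (pfun_rel (phi := fun a => a)) => // k k' _ _ ekk'.
by rewrite e (val_inj ekk').
Qed.

Lemma stepsD zs v K1 K2 w B :
  steps b zs v (fun w B => K1 w B + K2 w B) w B = steps b zs v K1 w B + steps b zs v K2 w B.
Proof.
elim: zs v K1 K2 => [|z zs IH] [|x v] K1 K2 //=; rewrite -IH; apply: eq_steps => w' B'.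
by rewrite /step /emit; case: inso => [|a C]; ring.
Qed.

(** * Exchange of two adjacent colours *)

Section Swap.
Variables (c d : color).
Hypothesis cd : d = c.+1 :> nat.
Local Notation sg := (tperm c d).
Local Notation sgw := (map (omap sg)).
Let phi a : nat := if a == d then c else a.
Local Notation phiw := (map (omap phi)).

Lemma phi_mono a a' : leo a a' -> (phi a <= phi a')%N.
Proof.
rewrite /phi /leo; case: (eqVneq a d) => [->|nad]; case: (eqVneq a' d) => [->|_] //.
  by rewrite cd; apply: leq_trans.
by move=> le; rewrite -ltnS -cd ltn_neqAle le andbT.
Qed.

Lemma phi_sg a : phi (sg a) = phi a.
Proof.
rewrite /phi; case: tpermP => [->|->|] //; last by rewrite eqxx; case: ifP.
by rewrite eqxx; case: ifP.
Qed.

Lemma phi_eq a a' : phi a = phi a' -> a' = a \/ a' = sg a.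
Proof.
have [->|nac] := eqVneq a c; [|have [->|nad] := eqVneq a d].
- rewrite tpermL /phi; case: (c =P d) => [|_]; first by move=> ->; case: ifP => [/eqP|_ /val_inj]; auto.
  by case: (a' =P d) => [|_ /val_inj]; auto.
- rewrite tpermR /phi eqxx; case: (a' =P d) => [|_ /val_inj]; auto.
rewrite /phi (negPf nad); case: (a' =P d) => [_ /val_inj e|_ /val_inj]; last by auto.
by rewrite e eqxx in nac.
Qed.

Lemma sg_id t : c \notin colors t -> d \notin colors t -> sgw t = t.
Proof.
rewrite !mem_colors => ct dt; rewrite -[RHS]map_id; apply/eq_in_map => -[a|] //= at_.
congr Some; apply: tpermD; first by apply: contra ct => /eqP->.
by apply: contra dt => /eqP->.
Qed.

(** The fibres of [phi] are the orbits of [sg]. As c and d occur at most once each, the choice made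
    at one of them forces the choice at the other. *)
Lemma swap_related t t' : uniq (colors t) -> uniq (colors t') ->
  phiw t = phiw t' -> t' = t \/ t' = sgw t.
Proof.
elim: t t' => [|x t IH] [|x' t'] //=; first by left.
move=> ux ux' [ex et]; have ut : uniq (colors t) by case: (x) ux => //= a /andP[].
have ut' : uniq (colors t') by case: (x') ux' => //= a /andP[].
case: x x' ex ux ux' => [a|] [a'|] //=; last first.
  by move=> _ _ _; case: (IH _ ut ut' et) => ->; auto.
case=> e /andP[at_ _] /andP[at'_ _].
have [aP|aP] : sg a = a \/ (forall t, a \notin colors t -> sg a \notin colors t -> sgw t = t).
  case: tpermP => [->|->|]; [right|right|by left] => s cs ds; exact: sg_id.
  by case: (IH _ ut ut' et) => ->; case: (phi_eq e) => ->; rewrite /= ?aP; auto.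
case: (IH _ ut ut' et) => e2; case: (phi_eq e) => e1; rewrite /= e1 e2; auto.
  by right; rewrite aP // -e1 -e2.
left; rewrite aP //; move: at'_; rewrite e1 e2 colors_map.
by apply: contra => sat; apply/mapP; exists (sg a); rewrite ?tpermK.
Qed.

Lemma admissible_sg (al : color -> nat) j w B :
  admissible al j (sgw w) (map sg B) = admissible (al \o sg) j w B.
Proof. by rewrite /admissible colors_map !all_map. Qed.

(** If c or d is absent, [phi] is injective on the colours of v, so lengths are transported without
    ambiguity. *)
Lemma pfun_sg zs (al : color -> nat) j m v : size zs = size v ->
  (c \notin colors v) || (d \notin colors v) ->
  pfun zs al j m (sgw v) = pfun zs (al \o sg) j m v.
Proof.
move=> sz ncd; apply: (pfun_rel phi_mono); rewrite ?size_map //.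
  by rewrite -map_comp; apply: eq_map => -[a|] //=; rewrite phi_sg.
move=> k k'; rewrite colors_map => /mapP[l lv ->] kv' /=; rewrite phi_sg => /phi_eq[->//|e].
have [lc|nlc] := eqVneq l c; first by rewrite e lc tpermL in kv' ncd lv *; rewrite lv kv' in ncd.
have [ld|nld] := eqVneq l d; first by rewrite e ld tpermR in kv' ncd lv *; rewrite lv kv' in ncd.
by rewrite e !tpermD // eq_sym.
Qed.

(** Parallel outcomes of v and [sgw v] are equal or swapped. In the swapped case either both colours
    survive and induction applies, or one is gone and the two summands change places; hence the
    symmetrisation over [al] and [al \o sg]. *)
Lemma pfun_swap zs (al : color -> nat) j m v : size zs = size v -> uniq (colors v) ->
  pfun zs al j m v + pfun zs (al \o sg) j m v
    = pfun zs al j m (sgw v) + pfun zs (al \o sg) j m (sgw v).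
Proof.
have sgsg : (al \o sg) \o sg =1 al by move=> a /=; rewrite tpermK.
have single j' m' v' : size zs = size v' -> (c \notin colors v') || (d \notin colors v') ->
  pfun zs al j' m' v' + pfun zs (al \o sg) j' m' v'
    = pfun zs al j' m' (sgw v') + pfun zs (al \o sg) j' m' (sgw v').
  by move=> sz ncd; rewrite !pfun_sg // addrC (eq_pfun _ _ sgsg).
elim: m j v => [|m IH] j v sz uv; first by rewrite /= colors_map; case: (colors v).
have [ncd|] := boolP ((c \notin colors v) || (d \notin colors v)); first exact: single.
rewrite negb_or !negbK => /andP[cv dv] /=; rewrite -!stepsD.
apply: (steps_rel phi_mono) => //.
  by rewrite -map_comp; apply: eq_map => -[a|] //=; rewrite phi_sg.
move=> w w' B B' ew eB [sw _ pB] [_ _ pB'].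
have uw : uniq (colors w ++ B) by rewrite (perm_uniq pB).
have uw' : uniq (colors w' ++ B') by rewrite (perm_uniq pB') colors_map map_inj_uniq //; apply: perm_inj.
have colors_cat t (C : seq color) : colors (t ++ map Some C) = colors t ++ C.
  by rewrite /colors pmap_cat; congr (_ ++ _); elim: C => //= a C ->.
(* The carry is appended to the word so that a single alternative governs both. *)
have [] := @swap_related (w ++ map Some B) (w' ++ map Some B').
- by rewrite colors_cat.
- by rewrite colors_cat.
- by rewrite !map_cat ew -!map_comp; congr (_ ++ _); have := congr1 (map Some) eB; rewrite -!map_comp.
- have szw : size w' = size w by have := congr1 size ew; rewrite !size_map.
  by move/eqP; rewrite eqseq_cat // => /andP[/eqP-> /eqP/(inj_map Some_inj)->].
rewrite map_cat -map_comp => /eqP; rewrite eqseq_cat; last first.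
  by have := congr1 size ew; rewrite !size_map.
rewrite (_ : map (omap sg \o _) B = map Some (map sg B)); last by rewrite -map_comp.
case/andP=> /eqP-> /eqP/(inj_map Some_inj)->.
rewrite !admissible_sg.
have -> : admissible ((al \o sg) \o sg) j w B = admissible al j w B.
  by congr (_ && _); apply: eq_all => a; rewrite sgsg.
have szw : size zs = size w by rewrite sz sw.
have uw1 : uniq (colors w) by move: uw; rewrite cat_uniq => /and3P[].
have [ncd|] := boolP ((c \notin colors w) || (d \notin colors w)).
  rewrite !pfun_sg // (eq_pfun _ _ sgsg) //; exact: addrC.
rewrite negb_or !negbK => /andP[cw dw].
(* Both colours lie in w and neither in B, so exchanging their lengths leaves the test unchanged. *)
have -> : admissible (al \o sg) j w B = admissible al j w B.
  have nB a : a \in colors w -> a \notin B.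
    by move=> aw; move: uw; rewrite cat_uniq => /and3P[_ /hasPn nB _]; apply: contraL aw => /nB.
  congr (_ && _).
    apply: eq_in_all => a aB /=; rewrite tpermD //; apply: contraTneq aB => <-; exact: nB.
  rewrite -(all_map sg (fun a => (j < al a)%N)); apply: eq_all_r => a.
  rewrite -{1}(tpermK c d a) (mem_map (@perm_inj _ sg)).
  by case: tpermP => [->|->|]; rewrite ?cw ?dw.
case: ifP => _ //; exact: IH.
Qed.

End Swap.

(** Words start at their lowest position, so the tail consists of the positions above the head. *)
Fixpoint leads c d v : bool :=
  if v is x :: v' then ((x == Some d) ==> (Some c \in v')) && leads c d v' else true.

Lemma leads_mem c d v : leads c d v -> d \in colors v -> c \in colors v.
Proof.
elim: v => [|x v IH] //; rewrite !mem_colors !inE /= => /andP[/implyP xd lv].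
case/orP=> [|dv]; first by rewrite eq_sym => /xd->; rewrite orbT.
by rewrite -mem_colors IH ?orbT // mem_colors.
Qed.

(** The colour d is emitted only as the minimum of the carry. At that moment c, met earlier and
    smaller, must already have been emitted higher up. *)
Lemma steps_leads c d zs v K : (c < d)%N -> size zs = size v -> leads c d v ->
  (forall w B, outcome v w B -> leads c d w -> K w B = 0) ->
  steps b zs v K [::] [::] = 0.
Proof.
move=> cd; elim: zs v K => [|z zs IH] [|x v] K //=; first by move=> _ _; apply.
case=> sz /andP[xd lv] K0; apply: IH => // w B oB lw; rewrite /step /emit.
rewrite K0 ?add0r //=; last exact: outcome_None.
case eC: (inso x B) => [|a C]; rewrite ?mulr0 // K0 ?mulr0 //=; first exact: outcome_Some eC.
rewrite lw andbT; apply/implyP=> /eqP[ad]; rewrite -mem_colors.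
have [_ sI pI] := outcome_None x oB; rewrite eC ad /= in sI pI.
have : c \in colors (x :: v).
  apply: (@leads_mem c d); first by rewrite /= xd.
  by rewrite -(perm_mem pI) mem_cat mem_head orbT.
rewrite -(perm_mem pI) mem_cat inE => /orP[//|/orP[/eqP e|cC]]; first by rewrite e ltnn in cd.
have /allP/(_ c cC) := order_path_min (@leo_trans n) sI.
by rewrite /leo leqNgt cd.
Qed.

(** Row c is shorter and must end first, but by [steps_leads] d cannot survive in a column without
    c. *)
Lemma pfun_leads c d zs (al : color -> nat) j m v :
  (c < d)%N -> (al c < al d)%N -> size zs = size v -> leads c d v ->
  uniq (colors v) -> c \in colors v -> d \in colors v -> pfun zs al j m v = 0.
Proof.
move=> cd acd; elim: m j v => [|m IH] j v sz lv uv cv dv /=; first by case: colors cv.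
apply: (steps_leads cd) => // w B [sw sB pB] lw; case: ifP => //; rewrite /admissible.
case/andP=> /allP aB /allP aw.
have uw : uniq (colors w ++ B) by rewrite (perm_uniq pB).
move: cv dv; rewrite -!(perm_mem pB) !mem_cat => cwB dwB.
have cw : c \in colors w.
  case/orP: cwB => // cB; case/orP: dwB => [/(leads_mem lw)//|dB].
  by rewrite (eqP (aB _ cB)) (eqP (aB _ dB)) ltnn in acd.
case/orP: dwB => [dw|dB]; last first.
  by have := ltn_trans (aw _ cw) acd; rewrite (eqP (aB _ dB)) ltnn.
by apply: IH => //; [rewrite sz sw | move: uw; rewrite cat_uniq => /and3P[]].
Qed.

Section PfunExchange.
Variables (s : {rmorphism R -> R}) (p q : R).
Hypotheses (sp : s p = q) (sq : s q = p) (sb : s b = b).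

Lemma exch_pfun zs1 zs2 (al : color -> nat) j m v1 v2 :
  (forall z, z \in zs1 -> s z = z) -> (forall z, z \in zs2 -> s z = z) ->
  size zs1 = size v1 ->
  exch b s p q (fun x y => pfun (zs1 ++ p :: q :: zs2) al j m (v1 ++ x :: y :: v2)).
Proof.
move=> fix1 fix2; elim: m j v1 v2 => [|m IH] j v1 v2 sz /=.
  have zero : exists t u : R, [/\ s t = t, s u = u, 0 = t + p * u & 0 = q * (1 + b * p) * u].
    by exists 0, 0; rewrite !rmorph0 !mulr0 addr0.
  split=> [|a|a c _]; first by rewrite rmorph_nat.
  - rewrite /colors !pmap_cat /=; case: (pmap id v1) => [|? ?] /=; exact: zero.
  exists 0, 0; rewrite !rmorph0 !mulr0 addr0.
  by rewrite /colors !pmap_cat /=; case: (pmap id v1).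
apply: exch_steps => // w1 w2 B sw1.
apply: (@exch_if _ _ b s p q (fun x y => admissible al j (w1 ++ x :: y :: w2) B)); last first.
  by apply: IH; rewrite sz.
move=> x y; congr (_ && _); apply: eq_all_r => a; rewrite !mem_colors !mem_cat !inE.
by case: (_ == x); case: (_ == y).
Qed.

End PfunExchange.
End Partition.

(** * The recursion for atoms *)

Section AtomRecursion.
Local Open Scope ring_scope.
Variable n : nat.
Local Notation Zpoly := {mpoly {poly int}[n]}.
Implicit Types (i : 'I_n.-1) (f g : Zpoly).

Definition betaP : Zpoly := (beta)%:MP.
Definition zvars : seq Zpoly := [seq 'X_k | k <- enum 'I_n].
Definition id_word : seq (option 'I_n) := [seq Some k | k <- enum 'I_n].
(** The starting word is a basement column with each row at its own index. Its weight is an extra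
    factor, the product of all variables. *)
Definition partfun (al : 'I_n -> nat) m : Zpoly := pfun betaP zvars al 0 m id_word.

Lemma colors_id_word : colors id_word = enum 'I_n.
Proof. by rewrite /id_word; elim: (enum 'I_n) => //= k l ->. Qed.

Lemma enum_split i : exists e1 e2, enum 'I_n = e1 ++ simple_lo i :: simple_hi i :: e2.
Proof.
exists (take i (enum 'I_n)), (drop i.+2 (enum 'I_n)).
rewrite -{1}(cat_take_drop i (enum 'I_n)); congr (_ ++ _).
have lt1 : (i.+1 < size (enum 'I_n))%N by rewrite size_enum_ord simple_hi_subproof.
rewrite (drop_nth (simple_lo i)) ?(ltnW lt1) // (drop_nth (simple_lo i)) //.
congr (_ :: _ :: _); apply/val_inj; rewrite /= nth_enum_ord ?simple_hi_subproof //.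
exact/ltnW/simple_hi_subproof.
Qed.

Lemma zlo_neq_zhi i : zlo i - zhi i != 0.
Proof.
apply/eqP => /(congr1 (mcoeff U_(simple_lo i)))/eqP.
rewrite mcoeffB !mcoeffX eqxx mcoeff0 eq_mnm1.
case: (simple_hi i =P simple_lo i) => [/(congr1 val)/= /eqP|_]; first by rewrite gtn_eqF.
by rewrite subr0 oner_eq0.
Qed.

Lemma msym_simple_fix i k : k != simple_lo i -> k != simple_hi i ->
  msym (simple_refl i) 'X_k = 'X_k :> Zpoly.
Proof.
move=> klo khi; rewrite msymX; congr mpolyX; apply/mnmP=> l.
rewrite !mnmE tpermV; congr (nat_of_bool _).
rewrite -[X in X == tperm _ _ l](@tpermD _ (simple_lo i) (simple_hi i) k) 1?eq_sym //.
by rewrite (inj_eq perm_inj).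
Qed.

Lemma partfun_swap i (al : 'I_n -> nat) m :
  (al (simple_hi i) < al (simple_lo i))%N ->
  partfun (al \o simple_refl i) m = varpi_bar i (partfun al m).
Proof.
move=> lt_al.
set lo := simple_lo i; set hi := simple_hi i; set p := zlo i; set q := zhi i.
have lohi : hi = lo.+1 :> nat by [].
pose s : {rmorphism Zpoly -> Zpoly} := msym (simple_refl i).
have sb : s betaP = betaP by rewrite -[betaP]mulr1 mul_mpolyC -[LHS]/(msym _ _) msymZ msym1.
have sp : s p = q := msym_zlo i; have sq : s q = p := msym_zhi i.
have [e1 [e2 e12]] := enum_split i.
have fixz e : lo \notin e -> hi \notin e ->
    forall z : Zpoly, z \in [seq 'X_k | k <- e] -> s z = z.
  move=> loe hie z /mapP[k ke ->]; apply: msym_simple_fix.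
    by apply: contraNneq loe => klo; rewrite /lo -klo.
  by apply: contraNneq hie => khi; rewrite /hi -khi.
have [lo1 hi1 lo2 hi2] : [/\ lo \notin e1, hi \notin e1, lo \notin e2 & hi \notin e2].
  have := enum_uniq 'I_n; rewrite e12 cat_uniq /= !inE !negb_or.
  by case/and3P=> _ /and3P[-> -> _] /and3P[/andP[_ ->] -> _].
have ez : zvars = [seq 'X_k | k <- e1] ++ p :: q :: [seq 'X_k | k <- e2].
  by rewrite /zvars e12 map_cat.
pose F x y := pfun betaP zvars al 0 m ([seq Some k | k <- e1] ++ x :: y :: [seq Some k | k <- e2]).
have eF : id_word = [seq Some k | k <- e1] ++ Some lo :: Some hi :: [seq Some k | k <- e2].
  by rewrite /id_word e12 map_cat.
have eF' : map (omap (tperm lo hi)) id_word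
    = [seq Some k | k <- e1] ++ Some hi :: Some lo :: [seq Some k | k <- e2].
  rewrite eF map_cat /= tpermL tpermR -!map_comp; congr (_ ++ _ :: _ :: _).
    apply/eq_in_map => k ke /=; rewrite tpermD //.
      by apply: contraNneq lo1 => ->.
    by apply: contraNneq hi1 => ->.
  apply/eq_in_map => k ke /=; rewrite tpermD //.
    by apply: contraNneq lo2 => ->.
  by apply: contraNneq hi2 => ->.
have size_id : size zvars = size id_word by rewrite !size_map.
have := pfun_swap betaP lohi al 0 m size_id.
rewrite colors_id_word enum_uniq => /(_ isT).
(* In the exchanged word [lo] sits above [hi], and the exchanged lengths make row [lo] the shorter
   one. *)
rewrite [X in _ = _ + X](@pfun_leads _ _ _ lo hi); first last.
- by rewrite eF'; rewrite mem_colors mem_cat !inE eqxx !orbT.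
- by rewrite eF'; rewrite mem_colors mem_cat !inE eqxx !orbT.
- by rewrite colors_map colors_id_word map_inj_uniq ?enum_uniq //; apply: perm_inj.
- have leads_cat e v : hi \notin e -> leads lo hi (map Some e ++ v) = leads lo hi v.
    elim: e => [|k e IH] //=; rewrite inE negb_or => /andP[hk he].
    by rewrite IH // [_ == _]eq_sym (inj_eq Some_inj) (negPf hk).
  rewrite eF' leads_cat //= eqxx mem_head /= (inj_eq Some_inj) -val_eqE /= ltn_eqF //=.
  by rewrite -[map _ e2]cats0 leads_cat.
- by rewrite !size_map.
- by rewrite /= tpermL tpermR.
- by rewrite lohi.
rewrite addr0 => eZ.
have exF : exch betaP s p q F.
  by rewrite /F ez; apply: exch_pfun => //; try exact: fixz; rewrite !size_map.
have [_ _ /(_ lo hi)] := exF.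
case=> [|t [u [st su Fhl Flh]]]; first exact: leqW.
(* [varpi] fixes the symmetric t and kills [q * (1 + betaP * p) * u], because the product of
   [q * (1 + betaP * p)] and [p * (1 + betaP * q)] is symmetric. *)
have vF : varpi i (F (Some lo) (Some hi)) = F (Some hi) (Some lo).
  apply: (mulIf (zlo_neq_zhi i)); rewrite varpiP /varpi_num -/p -/q.
  rewrite Fhl Flh -[msym _ _]/(s _) !(st, su, rmorphM, rmorphD, rmorph1) sq sp sb.
  rewrite -!mul_mpolyC -/betaP; ring.
apply/eqP; rewrite eq_sym /varpi_bar subr_eq addrC; apply/eqP.
rewrite /partfun -/lo -/hi /simple_refl; rewrite [RHS]eZ eF' eF; exact: vF.
Qed.
End AtomRecursion.

(** * Peeling a reduced word *)

Section Words.
Variable n : nat.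
Implicit Types (i : 'I_n.-1) (u w : 'S_n) (s : seq 'I_n.-1).

Lemma simple_refl_lt i (a c : 'I_n) : a < c -> (a != simple_lo i) || (c != simple_hi i) ->
  simple_refl i a < simple_refl i c.
Proof.
rewrite -!val_eqE /simple_refl /=.
case: tpermP => [->|->|/eqP alo /eqP ahi]; case: tpermP => [->|->|/eqP clo /eqP chi] /=; lia.
Qed.

(** The strong exchange condition. Conjugation by successive letters moves the inverted pair through
    the word; since the identity inverts nothing, it meets its own letter, which is deleted. *)
Lemma exchange_word s (a c : 'I_n) :
  a < c -> (perm_of_word s)^-1%g c < (perm_of_word s)^-1%g a ->
  exists2 t, size t < size s & perm_of_word t = (perm_of_word s * tperm a c)%g.
Proof.
elim: s a c => [|i s IH] a c ac /=.
  by rewrite invg1 !perm1 ltnNge (ltnW ac).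
rewrite invMg !permM /simple_refl tpermV -/(simple_refl i) => lt_ca.
have [/andP[/eqP ea /eqP ec]|] := boolP ((a == simple_lo i) && (c == simple_hi i)).
  by exists s => //; rewrite ea ec -mulgA -/(simple_refl i) tperm2 mulg1.
rewrite negb_and => nac.
have [t lt_t def_t] := IH _ _ (simple_refl_lt ac nac) lt_ca.
exists (i :: t) => //=; rewrite def_t -!mulgA; congr (_ * _)%g.
by rewrite -tpermJ /conjg /simple_refl tpermV -!mulgA tperm2 mulg1.
Qed.

Lemma perm_length_le s : perm_length (perm_of_word s) <= size s.
Proof.
rewrite /perm_length; case: ex_minnP => m _; apply.
by apply/existsP; exists (in_tuple s).
Qed.

Lemma perm_act_simple i u (a : 'X_{1..n}) k :
  perm_act (u * simple_refl i)%g a k = perm_act u a (simple_refl i k).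
Proof. by rewrite !mnmE invMg permM /simple_refl tpermV. Qed.

(** If the two parts were equal, dropping i would give the same composition; if they increased,
    [exchange_word] would shorten the word. The strict descent feeds [partfun_swap]. *)
Lemma reduced_min_cons (lam : 'X_{1..n}) i s : is_partition lam ->
  min_length_rep lam (perm_of_word (i :: s)) -> reduced_word (perm_of_word (i :: s)) (i :: s) ->
  let u := perm_of_word s in
  [/\ min_length_rep lam u, reduced_word u s &
      perm_act u lam (simple_hi i) < perm_act u lam (simple_lo i)].
Proof.
move=> lam_part min_u /andP[_ /eqP sz_s] u; rewrite /= in sz_s min_u.
have lt_hi : perm_act u lam (simple_hi i) < perm_act u lam (simple_lo i).
  rewrite ltnNge; apply/negP=> le_hi.
  suff [t lt_t act_t] : exists2 t, size t < (size s).+1 &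
      perm_act (perm_of_word t) lam = perm_act (perm_of_word (i :: s)) lam.
    have := min_u _ act_t; rewrite leqNgt => /negP[]; rewrite /= -sz_s.
    exact: leq_ltn_trans (perm_length_le t) lt_t.
  move: le_hi; rewrite leq_eqVlt => /orP[/eqP e|].
    exists s => //; apply/mnmP=> k /=; rewrite perm_act_simple.
    by case: (tpermP (simple_lo i) (simple_hi i) k) => [->|->|].
  rewrite !mnmE => lt_lam.
  have [|t lt_t def_t] := @exchange_word s (simple_lo i) (simple_hi i) (leqnn _).
    by rewrite ltnNge; apply: contraTN lt_lam => /lam_part; rewrite -leqNgt.
  by exists t; [exact: ltnW | rewrite def_t].
have red_s : perm_length u = size s.
  apply/eqP; rewrite eqn_leq perm_length_le /=; rewrite /perm_length.
  case: ex_minnP => m /existsP[t /eqP def_t] _; rewrite -ltnS sz_s.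
  by rewrite -(size_tuple t); apply: leq_trans (perm_length_le (i :: t)); rewrite /= def_t.
split=> //; last by rewrite /reduced_word eqxx red_s eqxx.
move=> v act_v; rewrite -ltnS red_s sz_s.
rewrite {2}/perm_length; case: (ex_minnP (perm_length_subproof v)) => m /existsP[t /eqP def_t] _.
rewrite -(size_tuple t); apply: leq_trans (perm_length_le (i :: t)).
apply: min_u; apply/mnmP=> k; rewrite /= !perm_act_simple.
by rewrite def_t act_v.
Qed.

End Words.

(** * Tableaux of partition shape *)

Section Boxes.
Variables (n : nat) (al : 'X_{1..n}).
Implicit Types (S : filling al) (A B D : box al) (x y r : 'I_n).

Definition mk_box r j (ltj : j < al r) : box al := Tagged (fun i => 'I_(al i)) (Ordinal ltj).

Lemma box_col_lt A : box_col A < al (box_row A).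
Proof. by case: A => r k; apply: ltn_ord. Qed.

Lemma box_eq A B : box_row A = box_row B -> box_col A = box_col B -> A = B.
Proof.
case: A B => [r k] [r' k']; rewrite /box_row /box_col /= => e; move: k'; rewrite -e => k' ek.
by congr Tagged; apply: val_inj.
Qed.

Lemma anchor_mem S A : nonempty_boxes S -> exists2 x, x \in S A & x = anchor S A :> nat.
Proof.
move=> /forallP/(_ A); rewrite -card_gt0 => nz.
by have [x xA ex] := eq_bigmax_cond (fun x : 'I_n => x : nat) nz; exists x.
Qed.

Lemma le_anchor S A x : x \in S A -> x <= anchor S A.
Proof. exact: (@leq_bigmax_cond _ (mem (S A)) (fun x : 'I_n => x : nat)). Qed.

Lemma rows_decreaseP S : reflect
  (forall B A x y, box_row B = box_row A -> box_col B < box_col A -> x \in S B -> y \in S A -> y <= x)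
  (rows_decrease S).
Proof.
apply: (iffP forallP) => [H B A x y eBA lt xB yA|H B].
  move/(_ B)/forallP/(_ A)/implyP: H; rewrite eBA eqxx lt => /(_ isT).
  by move/forall_inP/(_ x xB)/forall_inP/(_ y yA).
apply/forallP=> A; apply/implyP=> /andP[/eqP e lt].
by apply/forall_inP=> x xB; apply/forall_inP=> y yA; apply: H lt _ _.
Qed.

Lemma columns_distinctP S : reflect
  (forall A B x, box_col A = box_col B -> x \in S A -> x \in S B -> A = B)
  (columns_distinct S).
Proof.
apply: (iffP forallP) => [H A B x e xA xB|H A].
  move/(_ A)/forallP/(_ B)/implyP: H; rewrite e eqxx /=.
  by case: eqP => // _ /(_ isT)/disjointFr/(_ xA); rewrite xB.
apply/forallP=> B; apply/implyP=> /andP[/eqP e nAB].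
rewrite -setI_eq0; apply/eqP/setP=> x; rewrite !inE; apply/negP=> /andP[xA xB].
by rewrite (H A B x) ?eqxx in nAB.
Qed.

Lemma entry_le_row S A x : S \in SSLT al -> x \in S A -> x <= box_row A.
Proof.
rewrite inE => /and5P[ne _ /rows_decreaseP rd _ /andP[_ /forallP fc]] xA.
have lt0 : 0 < al (box_row A) by apply: leq_ltn_trans (box_col_lt A).
pose B := mk_box lt0; have /implyP/(_ isT)/eqP eB := fc B.
have [y yB ey] := anchor_mem B ne; rewrite -[box_row A]/(box_row B) -eB -ey.
have [A0|A0] := posnP (box_col A).
  by have eAB : A = B; [apply: box_eq | rewrite ey le_anchor // -eAB].
exact: (rd B A y x erefl A0 yB xA).
Qed.

End Boxes.

(** Entries never exceed the row index. By induction on rows, an entry x below the index would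
    repeat the x of row x, which is long enough to reach the same column. *)
Lemma SSLT_partition n (lam : 'X_{1..n}) : is_partition lam ->
  SSLT lam = [set [ffun A => [set box_row A]]].
Proof.
move=> lam_part; apply/setP=> S; rewrite !inE; apply/idP/eqP=> [SS|->].
  have SSin : S \in SSLT lam by rewrite inE.
  case/and5P: SS => ne /columns_distinctP cd _ _ _.
  have mem A : box_row A \in S A /\ (forall x, x \in S A -> x = box_row A).
    have [m] := ubnP (box_row A); elim: m => // m IH in A *; rewrite ltnS => ltm.
    have uniqA x : x \in S A -> x = box_row A.
      move=> xA; apply/val_inj/eqP; rewrite eqn_leq (entry_le_row SSin xA) leqNgt; apply/negP=> ltx.
      have ltB : box_col A < lam x by apply: leq_trans (box_col_lt A) (lam_part _ _ (ltnW ltx)).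
      have [|xB _] := IH (mk_box ltB); first exact: leq_trans ltx ltm.
      by have eAB := cd A (mk_box ltB) x erefl xA xB; rewrite eAB /= ltnn in ltx.
    by split=> //; have [x xA _] := anchor_mem A ne; rewrite -(uniqA x xA).
  apply/ffunP=> A; rewrite ffunE; apply/setP=> x; rewrite inE.
  by have [rA uA] := mem A; apply/idP/eqP=> [/uA|->].
have anc A : anchor [ffun A => [set box_row A]] A = box_row A :> nat.
  by rewrite /anchor ffunE big_set1.
apply/and5P; split.
- by apply/forallP=> A; rewrite ffunE; apply/set0Pn; exists (box_row A); rewrite inE.
- apply/columns_distinctP=> A B x e; rewrite !ffunE !inE => /eqP-> /eqP e'; exact: box_eq.
- by apply/rows_decreaseP=> B A x y e _; rewrite !ffunE !inE => /eqP-> /eqP->; rewrite e.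
- apply/forallP=> A; apply/forallP=> B; apply/forallP=> C; apply/implyP; rewrite !anc.
  case/orP=> /and4P[/andP[/eqP eBA _] _ lt _]; first by rewrite eBA lt orbT.
  by rewrite lt.
apply/andP; split; last by apply/forallP=> A; rewrite anc eqxx implybT.
apply/forallP=> A; apply/forallP=> x; apply/implyP; rewrite /free_entry anc ffunE inE.
by case/andP=> /eqP->; rewrite eqxx.
Qed.

Lemma sum_SSLT_partition n (lam : 'X_{1..n}) : is_partition lam ->
  (\sum_(S in SSLT lam) beta ^+ excess S *: 'X_[wt S] = 'X_[lam] :> {mpoly {poly int}[n]})%R.
Proof.
move=> lam_part; rewrite SSLT_partition // big_set1.
have -> : excess [ffun A : box lam => [set box_row A]] = 0%N.
  by rewrite /excess big1 // => A _; rewrite ffunE cards1.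
rewrite expr0 scale1r; congr ('X_[_]); apply/mnmP=> i; rewrite mnmE.
rewrite -[RHS]card_ord.
pose f (k : 'I_(lam i)) : box lam := Tagged (fun i => 'I_(lam i)) k.
rewrite -(@card_imset _ _ f); last by move=> k k' /eqP; rewrite eq_Tagged => /eqP.
congr #|pred_of_set _|; apply/setP=> A; rewrite inE ffunE inE.
apply/eqP/imsetP=> [e|[k _ ->] //].
by case: A e => r k /= e; move: @f; rewrite e => f; exists k.
Qed.

(** * Summing out the free entries *)

Section FreeEntries.
Variables (n : nat) (al : 'X_{1..n}).
Local Notation box := (box al).
Local Notation anchors := {ffun box -> 'I_n}.
Implicit Types (S : filling al) (A B C D E : box) (x y r : 'I_n) (a : anchors).
Implicit Types (Y : {set box * 'I_n}).

Definition valid_anchors a : bool :=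
  [&& [forall A, forall B, (box_col A == box_col B) && (a A == a B) ==> (A == B)],
      [forall B, forall A, immediately_left B A ==> (a A <= a B)],
      [forall A, forall B, forall C, triple_i A B C || triple_ii A B C ==>
         (a C < a A) || (a B < a C)]
    & [forall A, (box_col A == 0) ==> (a A == box_row A)]].

(** As x is below the anchor of D, the boxes to the left of D impose nothing, and among those to the
    right only the neighbour matters. *)
Definition fits a D x : bool :=
  (x < a D) && [forall E, immediately_left D E ==> (a E <= x)].

(* Condition 4 determines the box A of a free entry x from x and the column. *)
Definition holds_free a A x : bool :=
  [&& [forall B, (box_col B == box_col A) ==> (a B != x)], fits a A x
    & [forall D, (box_col D == box_col A) && fits a D x ==> (a A <= a D)]].

Definition free_slots a : {set box * 'I_n} := [set p | holds_free a p.1 p.2].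

Definition anchors_of S : anchors := [ffun A => odflt (box_row A) (insub (anchor S A))].
Definition free_of a S : {set box * 'I_n} := [set p | (p.2 \in S p.1) && (p.2 != a p.1)].
Definition fill a Y : filling al := [ffun A => a A |: [set x | (A, x) \in Y]].

Lemma anchors_ofE S A : nonempty_boxes S -> anchors_of S A = anchor S A :> nat.
Proof.
move=> ne; rewrite ffunE; have [x _ <-] := anchor_mem A ne.
by rewrite insubT ?ltn_ord //= => lt; rewrite SubK.
Qed.

Lemma anchors_of_mem S A : nonempty_boxes S -> anchors_of S A \in S A.
Proof.
move=> ne; have [x xA ex] := anchor_mem A ne.
suff -> : anchors_of S A = x by [].
by apply: val_inj; rewrite /= anchors_ofE.
Qed.

Lemma right_neighbour D A : box_row D = box_row A -> box_col D < box_col A ->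
  exists2 E, immediately_left D E & box_col E <= box_col A /\ box_row E = box_row A.
Proof.
move=> eDA lt; have ltE : (box_col D).+1 < al (box_row D).
  by rewrite eDA; apply: leq_ltn_trans (box_col_lt A).
by exists (mk_box ltE); rewrite ?/immediately_left ?eqxx.
Qed.

Lemma valid_anchorsP a : reflect
  [/\ forall A B, box_col A = box_col B -> a A = a B -> A = B,
      forall B A, box_row B = box_row A -> box_col B <= box_col A -> a A <= a B,
      forall A B C, triple_i A B C || triple_ii A B C -> (a C < a A) || (a B < a C)
    & forall A, box_col A = 0 -> a A = box_row A]
  (valid_anchors a).
Proof.
apply: (iffP and4P) => [[/forallP inj /forallP row /forallP tr /forallP fc]|[inj row tr fc]].
  split=> [A B e eA|B A e|A B C|A A0].
  - by move/(_ A)/forallP/(_ B)/implyP: inj; rewrite e eA !eqxx => /(_ isT)/eqP.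
  - have [k] := ubnP (box_col A - box_col B); elim: k => // k IH in B e *.
    rewrite ltnS => lek; rewrite leq_eqVlt => /orP[/eqP e'|lt]; first by rewrite (box_eq e e').
    have [E lBE [leE eE]] := right_neighbour e lt.
    apply: leq_trans (IH E eE _ leE) _; last by move/(_ B)/forallP/(_ E)/implyP/(_ lBE): row.
    by case/andP: lBE => _ /eqP <-; lia.
  - by move/(_ A)/forallP/(_ B)/forallP/(_ C)/implyP: tr.
  by move/(_ A)/implyP: fc; rewrite A0 => /(_ isT)/eqP.
split.
- apply/forallP=> A; apply/forallP=> B; apply/implyP=> /andP[/eqP e /eqP eA].
  by rewrite (inj A B).
- apply/forallP=> B; apply/forallP=> A; apply/implyP=> /andP[/eqP e /eqP e'].
  by apply: row => //; rewrite -e'.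
- apply/forallP=> A; apply/forallP=> B; apply/forallP=> C; apply/implyP; exact: tr.
by apply/forallP=> A; apply/implyP=> /eqP/fc/eqP.
Qed.

(** Turns condition 4 into a condition on anchors alone. *)
Lemma can_holdP S x D : nonempty_boxes S -> rows_decrease S ->
  can_hold S x D = fits (anchors_of S) D x.
Proof.
move=> ne /rows_decreaseP rd; rewrite /can_hold /fits anchors_ofE //.
case ltx: (x < anchor S D) => //=; apply/rows_decreaseP/forallP => [rdp E|H B A x' y e lt].
  apply/implyP=> /andP[/eqP e /eqP e']; apply: (rdp D E x) => //; first by rewrite -e'.
    by rewrite ffunE eqxx setU11.
  rewrite [place _ _ _ _]ffunE; case: (E =P D) => [eED|_]; last exact: anchors_of_mem.
  by rewrite eED in e'; lia.
rewrite !ffunE; case: (B =P D) => [eB|_]; case: (A =P D) => [eA|_].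
- by rewrite eB eA ltnn in lt.
- rewrite eB in e lt *; rewrite !inE => /orP[/eqP-> yA|x'D yA]; last exact: (rd D A).
  have [E lE [leE eE]] := right_neighbour e lt.
  move/(_ E)/implyP/(_ lE): H; apply: leq_trans.
  move: leE; rewrite leq_eqVlt => /orP[/eqP e'|lt'].
    by rewrite (box_eq eE e') anchors_ofE // le_anchor.
  by apply: (rd E A) => //; apply: anchors_of_mem.
- rewrite eA in e lt *; rewrite !inE => x'B /orP[/eqP->|yD]; last exact: (rd B D).
  apply: leq_trans (ltnW ltx) _; have [d dD <-] := anchor_mem D ne.
  exact: (rd B D).
exact: rd.
Qed.

(** With [fill_SSLT], this identifies tableaux with pairs of valid anchors and an arbitrary set of
    free slots. *)
Lemma SSLT_decompose S : S \in SSLT al ->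
  [/\ valid_anchors (anchors_of S), free_of (anchors_of S) S \subset free_slots (anchors_of S)
    & fill (anchors_of S) (free_of (anchors_of S) S) = S].
Proof.
rewrite inE => /and5P[ne cdS rdS tr /andP[fe fc]].
have cd := columns_distinctP _ cdS; have rd := rows_decreaseP _ rdS.
have val_a : valid_anchors (anchors_of S).
  apply/and4P; split.
  - apply/forallP=> A; apply/forallP=> B; apply/implyP=> /andP[/eqP e /eqP eA].
    apply/eqP; apply: (cd _ _ _ e (anchors_of_mem A ne)); rewrite eA; exact: anchors_of_mem.
  - apply/forallP=> B; apply/forallP=> A; apply/implyP=> /andP[/eqP e /eqP e'].
    by apply: (rd B A); rewrite ?anchors_of_mem // -e'.
  - apply/forallP=> A; apply/forallP=> B; apply/forallP=> C; rewrite !anchors_ofE //.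
    by move/forallP: tr => /(_ A)/forallP/(_ B)/forallP/(_ C).
  apply/forallP=> A; apply/implyP=> A0; rewrite -val_eqE /= anchors_ofE //.
  by move/forallP/(_ A)/implyP: fc; apply.
split=> //.
  apply/subsetP=> -[A x]; rewrite !inE /= => /andP[xA nx].
  have free : free_entry S x A.
    by rewrite /free_entry xA /=; move: nx; rewrite -val_eqE /= anchors_ofE.
  move/forallP/(_ A)/forallP/(_ x)/implyP/(_ free)/andP: fe => [holdA /forallP low].
  apply/and3P; split; last 2 first.
  - by rewrite -can_holdP.
  - apply/forallP=> D; rewrite !anchors_ofE // -can_holdP //; exact: low.
  apply/forallP=> B; apply/implyP=> /eqP e; apply: contraNneq nx => eB.
  have eBA : B = A by apply: (cd B A x e _ xA); rewrite -eB anchors_of_mem.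
  by rewrite -eBA eB.
apply/ffunP=> A; rewrite ffunE; apply/setP=> x; rewrite !inE /=.
by case: eqP => [->|_]; rewrite ?andbT ?anchors_of_mem.
Qed.

(** * From anchors and free slots back to a tableau *)

Section Fill.
Variables (a : anchors) (Y : {set box * 'I_n}).
Hypotheses (val_a : valid_anchors a) (sub_Y : Y \subset free_slots a).
Let S := fill a Y.

Lemma fill_slot A x : (A, x) \in Y -> holds_free a A x.
Proof. by move/(subsetP sub_Y); rewrite inE. Qed.

Lemma fill_mem A x : (x \in S A) = (x == a A) || ((A, x) \in Y).
Proof. by rewrite ffunE !inE. Qed.

Lemma fill_anchor A : anchor S A = a A.
Proof.
apply/eqP; rewrite eqn_leq le_anchor ?fill_mem ?eqxx // andbT.
apply/bigmax_leqP=> x; rewrite fill_mem => /orP[/eqP->//|/fill_slot].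
by case/and3P=> _ /andP[/ltnW].
Qed.

Lemma free_of_fill : free_of a S = Y.
Proof.
apply/setP=> -[A x]; rewrite inE fill_mem /=; case: eqP => [->|_] /=; last by rewrite andbT.
apply/esym/negP => /fill_slot/and3P[_ /andP[]].
by rewrite ltnn.
Qed.

Lemma fill_nonempty : nonempty_boxes S.
Proof. by apply/forallP=> A; apply/set0Pn; exists (a A); rewrite fill_mem eqxx. Qed.

Lemma anchors_of_fill : anchors_of S = a.
Proof.
apply/ffunP=> A; apply: val_inj; rewrite /= anchors_ofE ?fill_anchor //.
exact: fill_nonempty.
Qed.

Lemma fill_SSLT : S \in SSLT al.
Proof.
have [inj row tr fc] := valid_anchorsP _ val_a.
have le_a A x : x \in S A -> x <= a A by rewrite -fill_anchor; apply: le_anchor.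
have rd : rows_decrease S.
  apply/rows_decreaseP=> B A x y e lt xB /le_a le_y; apply: leq_trans le_y _.
  move: xB; rewrite fill_mem => /orP[/eqP->|]; first by apply: row; rewrite // ltnW.
  case/fill_slot/and3P=> _ /andP[_ /forallP H] _.
  have [E lE [leE eE]] := right_neighbour e lt.
  by move/(_ E)/implyP/(_ lE): H; apply: leq_trans; apply: row.
rewrite inE fill_nonempty rd; apply/and5P; split=> //; last (apply/andP; split).
- apply/columns_distinctP=> A B x e; rewrite !fill_mem.
  case/orP=> [/eqP->|/fill_slot/and3P[/forallP H fA /forallP lowA]].
    case/orP=> [/eqP/inj->//|/fill_slot/and3P[/forallP/(_ A)]].
    by rewrite e !eqxx.
  case/orP=> [/eqP ex|/fill_slot/and3P[_ fB /forallP lowB]].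
    by move/(_ B): H; rewrite e ex !eqxx.
  (* Two boxes holding x as a free entry both have the least anchor, hence coincide. *)
  apply: inj => //; apply/val_inj/eqP; rewrite eqn_leq.
  move/(_ B)/implyP: lowA => ->; last by rewrite e eqxx.
  by move/(_ A)/implyP: lowB => ->; rewrite // e eqxx.
- apply/forallP=> A; apply/forallP=> B; apply/forallP=> C; apply/implyP; rewrite !fill_anchor.
  exact: tr.
- apply/forallP=> A; apply/forallP=> x; apply/implyP; rewrite /free_entry fill_anchor fill_mem.
  case/andP=> xA nx; have {xA nx} : holds_free a A x.
    by case/orP: xA => [/eqP ex|/fill_slot//]; rewrite ex eqxx in nx.
  case/and3P=> _ fA /forallP low; rewrite can_holdP ?fill_nonempty // anchors_of_fill fA.
  apply/forallP=> D; rewrite can_holdP ?fill_nonempty // anchors_of_fill !fill_anchor.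
  exact: low.
by apply/forallP=> A; apply/implyP=> /eqP/fc; rewrite fill_anchor => ->.
Qed.

End Fill.

Local Open Scope ring_scope.
Local Notation Zpoly := {mpoly {poly int}[n]}.

(** Each box has exactly one anchor, so the excess counts the free entries and each of them carries
    one [beta]. *)
Lemma monomial_anchors S : nonempty_boxes S ->
  beta ^+ excess S *: 'X_[wt S] =
  \prod_A 'X_(anchors_of S A) *
  \prod_(p in free_of (anchors_of S) S) (betaP n * 'X_(p.2)) :> Zpoly.
Proof.
move=> ne; rewrite mpolyXE_id.
have -> : \prod_i 'X_i ^+ wt S i = \prod_A \prod_(x in S A) 'X_x :> Zpoly.
  rewrite (exchange_big_dep predT) //=; apply: eq_bigr => i _.
  rewrite mnmE prodr_const; congr (_ ^+ _); by apply: eq_card => A; rewrite !inE.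
have -> : \prod_A \prod_(x in S A) 'X_x =
    \prod_A 'X_(anchors_of S A) * \prod_A \prod_(x in S A | x != anchors_of S A) 'X_x :> Zpoly.
  rewrite -big_split; apply: eq_bigr => A _.
  by rewrite (bigD1 (anchors_of S A)) // anchors_of_mem.
rewrite scalerAr; congr (_ * _).
rewrite [RHS](eq_bigl (fun p => (p.2 \in S p.1) && (p.2 != anchors_of S p.1))); last first.
  by move=> p; rewrite inE.
rewrite -(pair_big_dep predT (fun A x => (x \in S A) && (x != anchors_of S A))
                       (fun _ x => betaP n * 'X_x)) /=.
have -> : \prod_A \prod_(x in S A | x != anchors_of S A) (betaP n * 'X_x) =
  \prod_A (betaP n ^+ (#|S A| - 1)) * \prod_A \prod_(x in S A | x != anchors_of S A) 'X_x.
  rewrite -big_split; apply: eq_bigr => A _; rewrite big_split /=; congr (_ * _).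
  rewrite (eq_bigl (mem (S A :\ anchors_of S A))); last by move=> x; rewrite !inE andbC.
  rewrite prodr_const; congr (_ ^+ _).
  by rewrite [in RHS](cardsD1 (anchors_of S A)) anchors_of_mem // addnC addnK.
by rewrite prodrXr -rmorphXn /= mul_mpolyC.
Qed.

Lemma sum_subsets (T : finType) (Q : {set T}) (f : T -> Zpoly) :
  \sum_(Y : {set T} | Y \subset Q) \prod_(t in Y) f t = \prod_(t in Q) (1 + f t).
Proof.
(* The value 0 outside Q lets the product be expanded over all subsets of T. *)
have -> : \prod_(t in Q) (1 + f t) = \prod_t ((if t \in Q then f t else 0) + 1).
  by rewrite big_mkcond; apply: eq_bigr => t _; case: ifP; rewrite ?add0r // addrC.
rewrite bigA_distr big_mkcond; apply: eq_bigr => Y _.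
case: ifP => [/subsetP sY|/subsetPn[t yY nQ]].
  by rewrite [LHS]big_mkcond; apply: eq_bigr => t _; case: ifP => // /sY->.
by rewrite (bigD1 t) //= yY (negPf nQ) mul0r.
Qed.

Lemma sum_SSLT_anchors :
  \sum_(S in SSLT al) beta ^+ excess S *: 'X_[wt S] =
  \sum_(a | valid_anchors a) (\prod_A 'X_(a A)) *
     \prod_(p in free_slots a) (1 + betaP n * 'X_(p.2)) :> Zpoly.
Proof.
rewrite (partition_big anchors_of valid_anchors) /=; last by move=> S /SSLT_decompose[].
apply: eq_bigr => a val_a; rewrite -sum_subsets mulr_sumr.
rewrite (reindex_onto (fill a) (free_of a)) /=; last first.
  by move=> S /andP[/SSLT_decompose[_ _ e] /eqP <-].
apply: eq_big => [Y|Y /andP[/andP[SS /eqP ea] /eqP eY]].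
  apply/andP/idP => [[/andP[/SSLT_decompose[_ + _] /eqP ea] /eqP eY]|sY].
    by rewrite ea eY.
  by rewrite fill_SSLT // anchors_of_fill // free_of_fill // !eqxx.
rewrite monomial_anchors; last by move: SS; rewrite inE => /and5P[].
by rewrite ea eY.
Qed.

End FreeEntries.

(** * Chains of columns *)

Lemma big_tuple_cons (R : nmodType) (T : finType) k (F : k.+1.-tuple T -> R) :
  (\sum_t F t = \sum_(t : k.-tuple T) \sum_x F [tuple of x :: t])%R.
Proof.
rewrite exchange_big pair_big /=.
rewrite (reindex (fun p : T * k.-tuple T => [tuple of p.1 :: p.2])) //=.
exists (fun t => (thead t, [tuple of behead t])) => [[x t] _|t _] /=.
  by rewrite theadE; congr pair; apply: val_inj.
by rewrite [RHS]tuple_eta; apply: val_inj.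
Qed.

Section Chains.
Local Open Scope ring_scope.
Variables (n : nat) (R : comNzRingType) (b : R).
Local Notation color := 'I_n.
Local Notation word := (seq (option color)).
Local Notation leo := (@leo n).
Implicit Types (a c d : color) (x y : option color) (B : seq color) (v w : word).
Implicit Types (z : R) (zs : seq R) (K : word -> seq color -> R).

(* [rest v w] is the final carry of a transfer from v to w. *)
Fixpoint rest v w : seq color :=
  match v, w with
  | x :: v', y :: w' =>
    let B := inso x (rest v' w') in if y is Some _ then behead B else B
  | _, _ => [::]
  end.

Fixpoint follows v w : bool :=
  match v, w with
  | x :: v', y :: w' =>
    (if y is Some a then ohead (inso x (rest v' w')) == Some a else true) && follows v' w'
  | [::], [::] => true
  | _, _ => false
  end.

Fixpoint wprod zs v w : R :=
  match zs, v, w with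
  | z :: zs', x :: v', y :: w' => vweight b z x (rest v' w') * wprod zs' v' w'
  | _, _, _ => 1
  end.

(** Unfolds the continuations: a term is given by the word written, which determines its carries. *)
Lemma steps_sum k zs v K : size v = k -> size zs = k ->
  steps b zs v K [::] [::] =
  \sum_(w : k.-tuple (option color) | follows v w) wprod zs v w * K w (rest v w).
Proof.
elim: k zs v K => [|k IH] [|z zs] [|x v] //= K sv szs.
  by rewrite (big_pred1 [tuple]) ?mul1r // => w; rewrite tuple0 eqxx.
case: sv szs => sv [szs]; rewrite IH // [RHS]big_mkcond big_tuple_cons [LHS]big_mkcond.
apply: eq_bigr => w _ /=; case: ifP => [fw|_]; last by rewrite big1 // => y _; rewrite andbF.
rewrite /step /emit mulrA [_ * vweight _ _ _ _]mulrC mulrDr.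
rewrite (bigD1 None) //=; congr (_ + _).
case: (inso x _) => [|a B]; last first.
  rewrite (bigD1 (Some a)) //= eqxx /= big1 ?addr0 // => -[c|] // /andP[_ ne].
  by rewrite [Some a == _]eq_sym (negPf ne).
by rewrite mulr0 big1 // => -[c|].
Qed.

Fixpoint chain (al : color -> nat) j v (h : seq word) : bool :=
  if h is w :: h' then
    [&& follows v w, admissible al j w (rest v w) & chain al j.+1 w h']
  else colors v == [::].

Fixpoint hweight zs v (h : seq word) : R :=
  if h is w :: h' then wprod zs v w * hweight zs w h' else 1.

Lemma pfun_sum zs (al : color -> nat) j m v : size zs = n -> size v = n ->
  pfun b zs al j m v =
  \sum_(h : m.-tuple (n.-tuple (option color)) | chain al j v (map val h)) hweight zs v (map val h).
Proof.
move=> szs; elim: m j v => [|m IH] j v sv.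
  rewrite /= big_mkcond (big_pred1 [tuple]) /=; first by case: ifP.
  by move=> w; apply/esym/eqP/tuple0.
rewrite [RHS]big_mkcond big_tuple_cons exchange_big /= (steps_sum _ sv) // big_mkcond.
apply: eq_bigr => w _; case: (follows v w) => /=; last by rewrite big1.
case: (admissible _ _ _ _) => /=; last by rewrite big1 // mulr0.
rewrite IH ?size_tuple // mulr_sumr [LHS]big_mkcond /=; exact: eq_bigr.
Qed.

Lemma size_follows v w : follows v w -> size w = size v.
Proof. by elim: v w => [|x v IH] [|y w] //= /andP[_ /IH ->]. Qed.

Lemma follows_outcome v w : follows v w -> outcome v w (rest v w).
Proof.
elim: v w => [|x v IH] [|y w] //= /andP[ey /IH oB].
case: y ey => [a|_]; last exact: outcome_None.
case eB: (inso x (rest v w)) => [|c B] //= /eqP[ec]; rewrite -ec.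
exact: outcome_Some eB.
Qed.

Lemma mem_rest v w c : uniq (colors v) -> follows v w ->
  (c \in rest v w) = (Some c \in v) && (Some c \notin w).
Proof.
move=> uv /follows_outcome[_ _ pB]; rewrite -!mem_colors -(perm_mem pB) mem_cat.
have : uniq (colors w ++ rest v w) by rewrite (perm_uniq pB).
rewrite cat_uniq => /and3P[_ /hasPn nB _].
case cB: (c \in rest v w); last by rewrite orbF andbN.
by rewrite orbT (nB _ cB).
Qed.

Lemma uniq_follows v w : uniq (colors v) -> follows v w -> uniq (colors w).
Proof.
move=> uv /follows_outcome[_ _ pB].
have : uniq (colors w ++ rest v w) by rewrite (perm_uniq pB).
by rewrite cat_uniq => /and3P[].
Qed.

Lemma sub_follows v w c : follows v w -> Some c \in w -> Some c \in v.
Proof.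
by move=> /follows_outcome[_ _ pB]; rewrite -!mem_colors -(perm_mem pB) mem_cat => ->.
Qed.

Definition ipos v c : nat := index (Some c) v.

(** The greedy rule without the carry: when d is written, a smaller colour is either not yet met or
    already written higher up. Both triple conditions take this form. *)
Definition legal v w : Prop :=
  forall d, Some d \in w -> [/\ Some d \in v, ipos w d <= ipos v d
    & forall c, (c < d)%N -> Some c \in v ->
        (ipos v c < ipos w d)%N \/ (Some c \in w) /\ (ipos w d < ipos w c)%N]%N.

Lemma head_sorted a B : sorted leo (a :: B) -> forall c, c \in a :: B -> (a <= c)%N.
Proof.
move=> /(order_path_min (@leo_trans n))/allP H c; rewrite inE => /orP[/eqP->//|/H].
by [].
Qed.

Lemma uniq_colors_cons x v : uniq (colors (x :: v)) -> uniq (colors v).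
Proof. by case: x => [a|] //= /andP[]. Qed.

Lemma followsP v w : uniq (colors v) ->
  follows v w <-> [/\ size w = size v, uniq (colors w) & legal v w].
Proof.
elim: v w => [|x v IH] [|y w] uv; try by split=> // -[].
have uv' := uniq_colors_cons uv.
split=> [fw|[/= [sw] uw lw]].
  split; [exact: size_follows|exact: uniq_follows fw|].
  have [/andP[ey fw'] oB] := (fw, follows_outcome fw).
  have [_ _ lw] := (IH w uv').1 fw'.
  move=> d; rewrite inE => /orP[/eqP ey'|dw].
    have dv : Some d \in x :: v by apply: (sub_follows fw); rewrite -ey' mem_head.
    rewrite /ipos /= -ey' eqxx; split=> // c cd cv; right.
    rewrite -ey' in ey; have dc : (Some d == Some c) = false.
      by apply/eqP=> -[e]; rewrite e ltnn in cd.
    rewrite inE eq_sym dc /=; suff cw : Some c \in w by rewrite cw.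
    have oN := outcome_None x (follows_outcome fw'); case: oN => _ sI pI.
    move: ey sI pI; case: (inso x _) => // e C /= /eqP[->] sI pI.
    have : c \in colors (x :: v) by rewrite mem_colors.
    rewrite -(perm_mem pI) mem_cat mem_colors => /orP[//|/(head_sorted sI)].
    by rewrite leqNgt cd.
  have [dv le_d H] := lw d dw.
  have yd : (y == Some d) = false.
    apply/eqP=> ey'; have := uniq_follows uv fw; rewrite ey' /= mem_colors dw.
    by [].
  have xd : (x == Some d) = false.
    by apply/eqP=> ex; move: uv; rewrite ex /= mem_colors dv.
  rewrite inE dv orbT /ipos /= yd xd; split=> // c cd; rewrite inE => cv.
  case: (x =P Some c) => [_|/eqP xc]; first by left.
  have {}cv : Some c \in v by case/orP: cv => // /eqP e; rewrite e eqxx in xc.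
  have [lt|[cw lt]] := H c cd cv; first by left.
  right; rewrite inE cw orbT; split=> //; case: (y =P Some c) => // ey'.
  by have := uniq_follows uv fw; rewrite ey' /= mem_colors cw.
have uw' := uniq_colors_cons uw.
have fw : follows v w.
  apply/(IH _ uv'); split=> // d dw.
  have yd : (y == Some d) = false.
    by apply/eqP=> ey'; move: uw; rewrite ey' /= mem_colors dw.
  have [|+ + H] := lw d; first by rewrite inE dw orbT.
  rewrite inE /ipos /= yd [x == _]eq_sym; case: eqP => [ex|nx] //= dv le_d.
  split=> // c cd cv.
  have xc : (x == Some c) = false.
    by apply/eqP=> ex; move: uv; rewrite ex /= mem_colors cv.
  have [|lt|[cw lt]] := H c cd; first by rewrite inE cv orbT.
    by left; move: lt; rewrite /ipos /= yd xc.
  right; move: lt cw; rewrite inE /ipos /= yd; case: eqP => // nyc.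
  by case: eqP => // e; rewrite e in nyc.
rewrite /= fw andbT; case: y lw uw => [d|] // lw uw.
have [dv _ H] := lw d (mem_head _ _).
have [_ sI pI] := outcome_None x (follows_outcome fw).
have dI : d \in inso x (rest v w).
  have : d \in colors (x :: v) by rewrite mem_colors.
  by rewrite -(perm_mem pI) mem_cat => /orP[dw|//]; move: uw; rewrite /= dw.
have uI : uniq (colors (None :: w) ++ inso x (rest v w)) by rewrite (perm_uniq pI).
case eI: (inso x _) dI sI uI pI => [|e C] //= dI sI uI pI; apply/eqP; congr Some.
have le_ed := head_sorted sI dI.
(* A smaller head e of the carry would have been met but not written, against legality. *)
apply/val_inj/eqP; rewrite eqn_leq le_ed leqNgt; apply/negP=> lt_ed.
have ev : Some e \in x :: v.
  by rewrite -mem_colors -(perm_mem pI) mem_cat mem_head orbT.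
case: (H e lt_ed ev) => [|[]]; rewrite /ipos /= eqxx ?ltn0 // inE => /orP[/eqP[ee]|ew _].
  by rewrite ee ltnn in lt_ed.
move: uI; rewrite cat_uniq => /and3P[_ /hasPn/(_ e (mem_head _ _))].
by rewrite mem_colors ew.
Qed.

Lemma ipos_nth w k c : uniq (colors w) -> (k < size w)%N -> nth None w k = Some c -> ipos w c = k.
Proof.
rewrite /ipos; elim: w k => [|y w IH] [|k] //= uw; first by move=> _ ->; rewrite eqxx.
rewrite ltnS => ltk e; have := IH k (uniq_colors_cons uw) ltk e.
case: eqP => [ey|_ ->] // _; move: uw; rewrite ey /= mem_colors -e mem_nth //.
Qed.

Lemma mem_drop_ipos w k c : uniq (colors w) ->
  (Some c \in drop k w) = (Some c \in w) && (k <= ipos w c)%N.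
Proof.
rewrite /ipos; elim: w k => [|y w IH] [|k] uw //=; first by rewrite andbT.
rewrite IH ?(uniq_colors_cons uw) // inE [Some c == y]eq_sym.
case: eqP => [ey|] //=; rewrite ltn0; move: uw; rewrite ey /= mem_colors.
by case/andP=> /negPf-> _.
Qed.

Lemma follows_drop k v w : follows v w -> follows (drop k v) (drop k w).
Proof. by elim: k v w => [|k IH] [|x v] [|y w] //= /andP[_ /IH]. Qed.

Lemma uniq_drop k v : uniq (colors v) -> uniq (colors (drop k v)).
Proof. by elim: k v => [|k IH] [|x v] // /uniq_colors_cons/IH. Qed.

Lemma wprod_nth zs v w : follows v w -> size zs = size v ->
  wprod zs v w = \prod_(k < size v)
    vweight b (nth 0 zs k) (nth None v k) (rest (drop k.+1 v) (drop k.+1 w)).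
Proof.
elim: zs v w => [|z zs IH] [|x v] [|y w] //= fw; first by rewrite big_ord0.
case/andP: fw => _ fw [sz]; rewrite big_ord_recl /= !drop0; congr (_ * _).
exact: IH.
Qed.

Lemma chainP (al : color -> nat) j v h :
  chain al j v h <->
  (forall k, (k < size h)%N -> follows (nth [::] (v :: h) k) (nth [::] h k)
      /\ admissible al (j + k)%N (nth [::] h k) (rest (nth [::] (v :: h) k) (nth [::] h k)))
  /\ colors (last v h) = [::].
Proof.
elim: h j v => [|w h IH] j v /=; first by split=> [/eqP|[_ /eqP]].
split=> [/and3P[fw aw /IH[H e]]|[H e]].
  split=> // -[_|k ltk]; first by rewrite addn0.
  by have := H k ltk; rewrite addSnnS.
have [fw aw] := H 0%N isT; rewrite addn0 in aw; rewrite fw aw /=; apply/IH; split=> // k ltk.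
by rewrite addSnnS; apply: (H k.+1).
Qed.

Lemma hweight_nth zs v h :
  hweight zs v h = \prod_(k < size h) wprod zs (nth [::] (v :: h) k) (nth [::] h k).
Proof.
elim: h v => [|w h IH] v /=; first by rewrite big_ord0.
by rewrite big_ord_recl IH.
Qed.

End Chains.

(** * Anchors as chains *)

Section AnchorChains.
Variables (n : nat) (al : 'X_{1..n}) (m : nat).
Hypothesis al_lt : forall r : 'I_n, al r < m.
Local Notation box := (box al).
Local Notation anchors := {ffun box -> 'I_n}.
Local Notation word := (n.-tuple (option 'I_n)).
Implicit Types (A B C D E : box) (c d r x : 'I_n) (a : anchors) (h : m.-tuple word).

Lemma mem_id_word r : Some r \in id_word n.
Proof. by apply: map_f; rewrite mem_enum. Qed.

Lemma ipos_id_word r : ipos (id_word n) r = r.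
Proof. by rewrite /ipos index_map ?index_enum_ord // => ? ? []. Qed.

Lemma size_id_word : size (id_word n) = n.
Proof. by rewrite size_map size_enum_ord. Qed.

(* Column [j.+1] holds the anchors of the boxes in column [j]; column 0 is the basement. *)
Definition apos a j r : 'I_n :=
  if j is k.+1 then (if insub k is Some l then a (Tagged (fun i => 'I_(al i)) (l : 'I_(al r))) else r)
  else r.

Lemma aposS a D : apos a (box_col D).+1 (box_row D) = a D.
Proof.
case: D => r k; rewrite /apos /box_col /box_row /= insubT ?ltn_ord //= => lt.
by congr (a (Tagged _ _)); apply: val_inj.
Qed.

Lemma apos_box a k r (lt : k < al r) : apos a k.+1 r = a (mk_box lt).
Proof. exact: aposS (mk_box lt). Qed.

Definition aword a j : word := [tuple [pick r | (j <= al r) && (apos a j r == x)] | x < n].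

Definition enc a : m.-tuple word := [tuple aword a j.+1 | j < m].

Definition cols h : seq (seq (option 'I_n)) := map val h.

(** The basement is not stored in [h], so box column k is entry k. On chains the default of [insubd]
    does not occur, see [decE]. *)
Definition dec h : anchors :=
  [ffun A => insubd (box_row A) (ipos (nth [::] (cols h) (box_col A)) (box_row A))].

Lemma size_cols h : size (cols h) = m.
Proof. by rewrite size_map size_tuple. Qed.

Lemma nth_cols_enc a k : k < m -> nth [::] (cols (enc a)) k = aword a k.+1.
Proof.
move=> ltk; rewrite (nth_map (nseq_tuple n None)) ?size_tuple //.
by rewrite -[k]/(nat_of_ord (Ordinal ltk)) -tnth_nth tnth_mktuple.
Qed.

(** * From anchors to a chain of words *)

Section OfAnchors.
Variable a : anchors.
Hypothesis val_a : valid_anchors a.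

Lemma apos_inj j r d : j <= al r -> j <= al d -> apos a j r = apos a j d -> r = d.
Proof.
have [inj _ _ _] := valid_anchorsP _ val_a.
by case: j => [|k] // kr kd; rewrite !apos_box => /(inj (mk_box kr) (mk_box kd) erefl)/(congr1 (@box_row _ _)).
Qed.

Lemma nth_aword j x r : (nth None (aword a j) x == Some r) = (j <= al r) && (apos a j r == x).
Proof.
rewrite -tnth_nth tnth_mktuple; case: pickP => [d /andP[jd /eqP ed]|/(_ r) /= ->] //.
apply/eqP/andP=> [[<-]|[jr /eqP er]]; first by rewrite jd ed.
by congr Some; apply: (@apos_inj j) => //; rewrite ed er.
Qed.

Lemma mem_aword j r : (Some r \in (aword a j : seq _)) = (j <= al r).
Proof.
apply/idP/idP=> [/(nthP None)[x]|jr].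
  rewrite size_tuple => ltx /eqP; rewrite (nth_aword j (Ordinal ltx)) => /andP[].
  by [].
have : nth None (aword a j) (apos a j r) == Some r by rewrite nth_aword jr eqxx.
by move/eqP <-; rewrite mem_nth // size_tuple.
Qed.

Lemma uniq_colors_nth (w : seq (option 'I_n)) :
  (forall k l c, nth None w k = Some c -> nth None w l = Some c -> k = l) -> uniq (colors w).
Proof.
elim: w => [|y w IH] // H.
have uw : uniq (colors w).
  by apply: IH => k l c ek el; have /eq_add_S := H k.+1 l.+1 c ek el.
case: y H => [c|] //= H; rewrite uw andbT mem_colors; apply/negP=> /(nthP None)[k ltk ek].
by have := H 0 k.+1 c erefl ek.
Qed.

Lemma uniq_aword j : uniq (colors (aword a j)).
Proof.
apply: uniq_colors_nth => k l c ek el.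
have ltn k' : nth None (aword a j) k' = Some c -> k' < n.
  by rewrite ltnNge => e; apply/negP=> le; rewrite nth_default ?size_tuple in e.
have/eqP := ek; have/eqP := el.
rewrite (nth_aword j (Ordinal (ltn _ ek))) (nth_aword j (Ordinal (ltn _ el))).
by move=> /andP[_ /eqP->] /andP[_ /eqP/(congr1 val)].
Qed.

Lemma ipos_aword j r : j <= al r -> ipos (aword a j) r = apos a j r.
Proof.
move=> jr; apply: ipos_nth; rewrite ?uniq_aword ?size_tuple //.
by apply/eqP; rewrite nth_aword jr eqxx.
Qed.

Lemma aword0 : aword a 0 = id_word n :> seq _.
Proof.
apply: (@eq_from_nth _ None); rewrite size_tuple ?size_id_word // => k ltk.
rewrite -[k]/(val (Ordinal ltk)); set x := Ordinal ltk.
have /eqP -> : nth None (aword a 0) x == Some x by rewrite nth_aword /=.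
by rewrite (nth_map x) ?size_enum_ord // nth_ord_enum.
Qed.

(** Triple (ii) keeps the next anchor of row d above the current anchor of row c, and row c only
    decreases. *)
Lemma apos_unflipped j c d : c < d -> al c < al d -> j <= al c -> apos a j c < apos a j d.
Proof.
have [_ row tr fc] := valid_anchorsP _ val_a.
move=> cd acd; elim: j => [|j IH] // ltc; have ltd := ltn_trans ltc acd.
rewrite !apos_box; case: j IH ltc ltd => [|j] IH ltc ltd; first by rewrite !fc.
have := IH (ltnW ltc); rewrite (apos_box _ (ltnW ltc)) (apos_box _ (ltnW ltd)) => lt.
have := tr (mk_box ltd) (mk_box (ltnW ltd)) (mk_box (ltnW ltc)).
rewrite /triple_ii /immediately_left /box_row /box_col /= !eqxx cd acd orbT => /(_ isT).
case/orP=> [lt1|]; last by rewrite ltnNge (ltnW lt).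
by apply: leq_ltn_trans lt1; apply: row => //=; rewrite /box_col /=.
Qed.

(** For rows c < d, legality is triple (i) if row c is at least as long. Otherwise it is triple
    (ii), whose second alternative [apos_unflipped] excludes. *)
Lemma follows_aword k : follows (aword a k) (aword a k.+1).
Proof.
have [_ row tr fc] := valid_anchorsP _ val_a.
apply/followsP; first exact: uniq_aword.
split; rewrite ?size_tuple ?uniq_aword // => d.
rewrite !mem_aword => ltd; split; first exact: ltnW.
  rewrite !ipos_aword ?(ltnW ltd) //; case: k ltd => [|k] ltd.
    by rewrite (apos_box _ ltd) fc.
  by rewrite (apos_box _ ltd) (apos_box _ (ltnW ltd)); apply: row => //=; rewrite /box_col /=.
move=> c cd; rewrite !mem_aword => lec; rewrite !(ipos_aword ltd) (ipos_aword lec).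
have [lec'|lt_cd] := leqP (al d) (al c).
  have ltc := leq_trans ltd lec'.
  case: k ltd lec ltc => [|k] ltd lec ltc.
    by left; rewrite (apos_box _ ltd) fc.
  have := tr (mk_box ltc) (mk_box lec) (mk_box ltd).
  rewrite /triple_i /immediately_left /box_row /box_col /= !eqxx cd lec' => /(_ isT).
  rewrite -!apos_box => /orP[lt|lt]; last by left.
  by right; split=> //; rewrite ipos_aword.
left; case: k ltd lec => [|k] ltd lec; first by rewrite (apos_box _ ltd) fc.
have := tr (mk_box ltd) (mk_box (ltnW ltd)) (mk_box lec).
rewrite /triple_ii /immediately_left /box_row /box_col /= !eqxx cd lt_cd orbT => /(_ isT).
rewrite -!apos_box => /orP[//|]; rewrite ltnNge; move/negP; case.
exact/ltnW/apos_unflipped.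
Qed.

Lemma chain_enc : chain al 0 (id_word n) (cols (enc a)).
Proof.
have nth_h k : k <= m -> nth [::] (id_word n :: cols (enc a)) k = aword a k.
  by case: k => [|k] lek /=; rewrite ?aword0 // nth_cols_enc.
apply/chainP; split=> [k|].
  rewrite size_cols => ltk; rewrite nth_h 1?ltnW // nth_cols_enc //.
  split; first exact: follows_aword.
  apply/andP; split; apply/allP=> c.
    rewrite mem_rest ?uniq_aword ?follows_aword // !mem_aword add0n -ltnNge => /andP[].
    by rewrite ltnS eqn_leq => -> ->.
  by rewrite mem_colors mem_aword.
have -> : last (id_word n) (cols (enc a)) = aword a m.
  by rewrite (last_nth [::]) size_cols nth_h.
case e: colors => [|c s] //; have : c \in colors (aword a m) by rewrite e mem_head.
by rewrite mem_colors mem_aword leqNgt al_lt.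
Qed.

Lemma dec_enc : dec (enc a) = a.
Proof.
apply/ffunP=> A; rewrite ffunE nth_cols_enc; last first.
  exact: ltn_trans (box_col_lt A) (al_lt _).
by rewrite ipos_aword ?box_col_lt // aposS; apply: val_inj; rewrite val_insubd ltn_ord.
Qed.

End OfAnchors.

(** * From a chain of words to anchors *)

Section OfChain.
Variable h : m.-tuple word.
Hypothesis ch : chain al 0 (id_word n) (cols h).
Let hcol k := nth [::] (id_word n :: cols h) k.

Lemma hcol_follows k : k < m -> follows (hcol k) (hcol k.+1).
Proof. by move=> ltk; have /chainP[/(_ k)] := ch; rewrite size_cols => /(_ ltk)[]. Qed.

Lemma uniq_hcol k : k <= m -> uniq (colors (hcol k)).
Proof.
elim: k => [_|k IH ltk]; first by rewrite /hcol /= colors_id_word enum_uniq.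
exact: uniq_follows (IH (ltnW ltk)) (hcol_follows ltk).
Qed.

Lemma size_hcol k : k <= m -> size (hcol k) = n.
Proof.
elim: k => [_|k IH ltk]; first by rewrite /hcol /= size_id_word.
by rewrite (size_follows (hcol_follows ltk)) IH // ltnW.
Qed.

Lemma mem_hcol k r : k <= m -> (Some r \in hcol k) = (k <= al r).
Proof.
elim: k r => [|k IH] r lek; first by rewrite mem_id_word.
have fw := hcol_follows lek; have uv := uniq_hcol (ltnW lek).
have /chainP[/(_ k)] := ch; rewrite size_cols add0n => /(_ lek)[_ /andP[/allP out /allP stay]] _.
apply/idP/idP; first by rewrite -mem_colors => /stay.
move=> ltr; move: (mem_rest r uv fw); rewrite IH ?(ltnW lek) // (ltnW ltr) /=.
case: (boolP (r \in rest _ _)) => [/out/eqP e|_]; first by rewrite e ltnn in ltr.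
by move/esym/negbT; rewrite negbK.
Qed.

Lemma hcol_legal k d : k < al d ->
  ipos (hcol k.+1) d <= ipos (hcol k) d /\
  (forall c, c < d -> k <= al c ->
   ipos (hcol k) c < ipos (hcol k.+1) d \/
   k < al c /\ ipos (hcol k.+1) d < ipos (hcol k.+1) c).
Proof.
move=> ltd; have ltk := ltn_trans ltd (al_lt d).
have [_ _ /(_ d)] := (followsP _ (uniq_hcol (ltnW ltk))).1 (hcol_follows ltk).
rewrite mem_hcol // => /(_ ltd)[_ le H]; split=> // c cd lec.
by have := H c cd; rewrite !mem_hcol ?(ltnW ltk) // => /(_ lec).
Qed.

(** The basement enforces condition 5. To land on a position y < r, colour r would need colour y to
    be written above y already, but colours only move down. *)
Lemma hcol1 r : 0 < al r -> ipos (hcol 1) r = r.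
Proof.
move=> gt0; have [le H] := hcol_legal gt0; rewrite /hcol /= ipos_id_word in le H.
apply/eqP; rewrite eqn_leq le leqNgt; apply/negP=> lt.
pose y := Ordinal (ltn_trans lt (ltn_ord r)).
case: (H y lt isT) => [|[gt0y]]; first by rewrite ipos_id_word ltnn.
by rewrite ltnNge; have [] := hcol_legal gt0y; rewrite /hcol /= ipos_id_word => ->.
Qed.

(* Once the upper of two rows has the larger anchor it keeps it. *)
Lemma hcol_flipped k c d : c < d -> k <= al d -> k <= al c ->
  ipos (hcol k) d < ipos (hcol k) c -> al d <= al c.
Proof.
move=> cd; have [l] := ubnP (al d - k); elim: l k => // l IH k ltl; rewrite leq_eqVlt.
case/orP=> [/eqP->//|ltd] lec flip.
have [le /(_ c cd lec)] := hcol_legal ltd.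
case=> [lt|[ltc flip']]; first by lia.
by apply: IH flip'; lia.
Qed.

Lemma decE A : dec h A = ipos (hcol (box_col A).+1) (box_row A) :> nat.
Proof.
rewrite ffunE val_insubd; case: ifP => //= /negP[].
have lt := ltn_trans (box_col_lt A) (al_lt (box_row A)).
apply: leq_trans (eq_leq (size_hcol lt)).
have : Some (box_row A) \in hcol (box_col A).+1 by rewrite mem_hcol // box_col_lt.
by rewrite -index_mem.
Qed.

Lemma dec_valid : valid_anchors (dec h).
Proof.
have lt_m A : box_col A < m := ltn_trans (box_col_lt A) (al_lt (box_row A)).
apply/and4P; split.
- apply/forallP=> A; apply/forallP=> B; apply/implyP=> /andP[/eqP e /eqP/(congr1 val)].
  rewrite /= !decE e /ipos => eAB; apply/eqP/box_eq => //.
  have mA : Some (box_row A) \in hcol (box_col B).+1 by rewrite mem_hcol // -e box_col_lt.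
  have mB : Some (box_row B) \in hcol (box_col B).+1 by rewrite mem_hcol // box_col_lt.
  by have := nth_index None mA; rewrite eAB nth_index // => -[].
- apply/forallP=> B; apply/forallP=> A; apply/implyP=> /andP[/eqP e /eqP e'].
  by rewrite !decE e e'; have [] := hcol_legal (box_col_lt A).
- apply/forallP=> A; apply/forallP=> B; apply/forallP=> C; apply/implyP; rewrite !decE.
  case/orP=> /and4P[/andP[/eqP eBA /eqP cBA] /eqP eC lt le].
    rewrite eBA cBA eC; have ltC := box_col_lt C; rewrite eC in ltC.
    have [_ /(_ _ lt)] := hcol_legal ltC.
    case; first exact/ltnW/box_col_lt.
      by move=> ->; rewrite orbT.
    by case=> _ ->.
  rewrite eBA cBA eC cBA; have ltC := box_col_lt C; rewrite eC cBA in ltC.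
  have [_ /(_ _ lt)] := hcol_legal (box_col_lt A).
  case; first by rewrite -cBA -eC; exact: box_col_lt.
    by move=> ->.
  (* In triple (ii) the upper row is strictly shorter, so this alternative contradicts
     [hcol_flipped]. *)
  case=> ltC' flip; have := hcol_flipped lt (box_col_lt A) ltC' flip.
  by rewrite leqNgt le.
apply/forallP=> A; apply/implyP=> /eqP A0; rewrite -val_eqE /= decE A0 hcol1 //.
by have := box_col_lt A; rewrite A0.
Qed.

Lemma enc_dec : enc (dec h) = h.
Proof.
have vd := dec_valid.
apply: eq_from_tnth => k; rewrite tnth_mktuple; apply: val_inj.
have -> : val (tnth h k) = hcol k.+1.
  rewrite /hcol /= (nth_map (nseq_tuple n None)) ?size_tuple //.
  by rewrite (tnth_nth (nseq_tuple n None)).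
have ltk := ltn_ord k.
apply: (@eq_from_nth _ None) => [|x]; rewrite size_tuple ?size_hcol // => ltx.
have key r : (nth None (aword (dec h) k.+1) x == Some r) = (nth None (hcol k.+1) x == Some r).
  rewrite (nth_aword vd _ (Ordinal ltx)); apply/andP/eqP=> [[ltr /eqP/(congr1 val)]|e].
    rewrite (apos_box _ ltr) /= decE /= => <-.
    by rewrite nth_index // mem_hcol.
  have ltr : k < al r by rewrite -mem_hcol // -e mem_nth ?size_hcol.
  split=> //; rewrite (apos_box _ ltr) -val_eqE /= decE; apply/eqP.
  by apply: ipos_nth e; rewrite ?uniq_hcol ?size_hcol.
case e: (nth None (hcol k.+1) x) key => [r|] key; first by apply/eqP; rewrite key.
by case e': (nth None _ x) key => [r|] // /(_ r); rewrite eqxx.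
Qed.

End OfChain.
End AnchorChains.

(** * Comparison of weights *)

Section Weights.
Local Open Scope ring_scope.
Variables (n : nat) (al : 'X_{1..n}) (m : nat).
Hypothesis al_le : forall r : 'I_n, (al r <= m)%N.
Local Notation box := (box al).
Local Notation anchors := {ffun box -> 'I_n}.
Local Notation Zpoly := {mpoly {poly int}[n]}.
Implicit Types (A B C D E : box) (c d r x : 'I_n) (a : anchors).

Lemma nth_zvars x : nth 0 (zvars n) x = 'X_x.
Proof. by rewrite (nth_map x) ?size_enum_ord // nth_ord_enum. Qed.

Section Column.
Variable a : anchors.
Hypothesis val_a : valid_anchors a.

(** A row is carried past x if its current anchor is above x and its next one is not. A row ending
    here stays carried, just as a box without right neighbour has no lower bound. *)
Lemma mem_rest_aword j x c :
  (c \in rest (drop x.+1 (aword a j.+1)) (drop x.+1 (aword a j.+2))) =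
  [exists D, [&& box_row D == c, box_col D == j & fits a D x]].
Proof.
rewrite mem_rest ?follows_drop ?follows_aword //; last exact/uniq_drop/uniq_aword.
rewrite !mem_drop_ipos ?uniq_aword // !mem_aword //.
apply/andP/existsP=> [[/andP[ltj lt_x] nE]|[D /and3P[/eqP <- /eqP <- /andP[lt_x /forallP H]]]].
  exists (mk_box ltj); rewrite /box_row /box_col /= !eqxx /= /fits.
  rewrite -(apos_box a ltj) -ipos_aword // lt_x.
  apply/forallP=> E; apply/implyP=> /andP[/eqP eE /eqP cE].
  have ltE := box_col_lt E; rewrite -cE -eE /box_row /box_col /= in ltE.
  have -> : E = mk_box ltE by apply: box_eq; rewrite /box_row /box_col /= -?eE -?cE.
  by move: nE; rewrite ltE /= ipos_aword // (apos_box _ ltE) -leqNgt.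
have ltD := box_col_lt D; rewrite ltD (ipos_aword val_a ltD) aposS lt_x; split=> //.
apply/negP=> /andP[ltE]; rewrite ipos_aword // (apos_box _ ltE) ltnNge.
by move/(_ (mk_box ltE))/implyP: H => -> //; rewrite /immediately_left !eqxx.
Qed.

(** At most one box of the column can hold x as a free entry: the one with the least anchor among
    those that fit. So each product has at most one factor, matching the three values of
    [vweight]. *)
Lemma column_weight j x :
  vweight (betaP n) 'X_x (nth None (aword a j.+1) x)
     (rest (drop x.+1 (aword a j.+1)) (drop x.+1 (aword a j.+2)))
  = (\prod_(A | (box_col A == j) && (a A == x)) 'X_x) *
    \prod_(A | (box_col A == j) && holds_free a A x) (1 + betaP n * 'X_x) :> Zpoly.
Proof.
have [inj _ _ _] := valid_anchorsP _ val_a.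
have [/existsP[D /andP[/eqP cD /eqP aD]]|noD] :=
    boolP [exists D, (box_col D == j) && (a D == x)].
  have /eqP -> : nth None (aword a j.+1) x == Some (box_row D).
    by rewrite nth_aword // -cD box_col_lt aposS aD eqxx.
  rewrite (big_pred1 D) => [|A]; last first.
    apply/andP/eqP=> [[/eqP cA /eqP aA]|->]; last by rewrite cD aD !eqxx.
    by apply: inj; rewrite ?cA ?aA.
  rewrite big_pred0 ?mulr1 // => A; apply/negP=> /andP[/eqP cA /and3P[/forallP/(_ D)]].
  by rewrite cA cD aD !eqxx.
have free_x D : box_col D = j -> a D != x.
  move=> cD; apply: contraNneq noD => aD; apply/existsP; exists D.
  by rewrite cD aD !eqxx.
rewrite [X in _ = X * _]big_pred0 ?mul1r => [|A]; last first.
  by apply/negP=> /andP[/eqP/free_x/negP].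
case e: (nth None _ x) => [r|].
  have : nth None (aword a j.+1) x == Some r by rewrite e.
  rewrite nth_aword // => /andP[ltr]; rewrite (apos_box _ ltr) => aD.
  by have /negP := free_x (mk_box ltr) erefl.
have [/existsP[D /andP[/eqP cD fD]]|noF] := boolP [exists D, (box_col D == j) && fits a D x].
  have : box_row D \in rest (drop x.+1 (aword a j.+1)) (drop x.+1 (aword a j.+2)).
    by rewrite mem_rest_aword; apply/existsP; exists D; rewrite cD fD !eqxx.
  case: rest => //= _ _ _.
  have PD : (box_col D == j) && fits a D x by rewrite cD eqxx.
  case: (@arg_minnP _ D (fun A => (box_col A == j) && fits a A x) (fun A => a A : nat) PD) => D0 /andP[/eqP cD0 fD0] minD0.
  have holdD0 : holds_free a D0 x.
    apply/and3P; split=> //; apply/forallP=> B; apply/implyP; rewrite cD0.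
      by move=> /eqP/free_x.
    exact: minD0.
  rewrite (big_pred1 D0) // => A; apply/andP/eqP=> [[/eqP cA]|->]; last by rewrite cD0 eqxx.
  case/and3P=> _ fA /forallP lowA; apply: inj; first by rewrite cA.
  apply/val_inj/eqP; rewrite eqn_leq minD0 ?cA ?eqxx // andbT.
  by move/(_ D0)/implyP: lowA; apply; rewrite cA cD0 eqxx.
rewrite big_pred0 => [|A].
  case eR: rest => [|c s] //=.
  have := mem_rest_aword j x c; rewrite eR mem_head => /esym/existsP[D /and3P[_ cD fD]].
  by case/existsP: noF; exists D; rewrite cD fD.
apply/negP=> /andP[cA /and3P[_ fA _]]; case/existsP: noF; exists A.
by rewrite cA fA.
Qed.

Lemma hweight_enc :
  hweight (betaP n) (zvars n) (id_word n) (map val (enc m.+1 a)) =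
  (\prod_k 'X_k) * ((\prod_A 'X_(a A)) *
     \prod_(p in free_slots a) (1 + betaP n * 'X_(p.2))) :> Zpoly.
Proof.
have al_lt r : (al r < m.+1)%N by rewrite ltnS.
have nth_h k : (k <= m.+1)%N -> nth [::] (id_word n :: cols (enc m.+1 a)) k = aword a k.
  by case: k => [|k] lek; [rewrite aword0 | apply: nth_cols_enc].
rewrite hweight_nth -/(cols _) size_cols.
rewrite (eq_bigr (fun k : 'I_m.+1 => \prod_x vweight (betaP n) 'X_x (nth None (aword a k) x)
     (rest (drop x.+1 (aword a k)) (drop x.+1 (aword a k.+1))))); last first.
  move=> k _; rewrite nth_h 1?ltnW // nth_cols_enc // wprod_nth ?follows_aword //; last first.
    by rewrite size_map size_enum_ord size_tuple.
  by rewrite size_tuple; apply: eq_bigr => x _; rewrite nth_zvars.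
(* The factor of index 0 is the basement, where every position is occupied. *)
rewrite big_ord_recl /=; congr (_ * _).
  apply: eq_bigr => x _; have /eqP -> // : nth None (aword a 0) x == Some x.
  by rewrite nth_aword /=.
rewrite (eq_bigr (fun j : 'I_m =>
   (\prod_x \prod_(A | (box_col A == j) && (a A == x)) 'X_x) *
   \prod_x \prod_(A | (box_col A == j) && holds_free a A x) (1 + betaP n * 'X_x))); last first.
  by move=> j _; rewrite -big_split; apply: eq_bigr => x _; rewrite /bump /= add1n column_weight.
have lt_m A : (box_col A < m)%N by apply: leq_trans (box_col_lt A) (al_le _).
rewrite big_split /=; congr (_ * _).
  rewrite [RHS](partition_big (fun A => Ordinal (lt_m A)) predT) //=; apply: eq_bigr => j _.
  rewrite [RHS](partition_big a predT) //=; apply: eq_bigr => x _.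
  by apply: eq_big => // A /andP[_ /eqP->].
under [RHS]eq_bigl do rewrite inE.
rewrite -(pair_big_dep predT (holds_free a) (fun _ x => 1 + betaP n * 'X_x)) /=.
rewrite [RHS](partition_big (fun A => Ordinal (lt_m A)) predT) //=; apply: eq_bigr => j _.
rewrite (exchange_big_dep (fun A => box_col A == j)) /=; last by move=> x A _ /andP[].
by apply: eq_bigr => A cA; apply: eq_bigl => x; rewrite cA.
Qed.

End Column.

Lemma partfun_SSLT :
  partfun al m.+1 = (\prod_k 'X_k) * \sum_(S in SSLT al) beta ^+ excess S *: 'X_[wt S].
Proof.
have al_lt r : (al r < m.+1)%N by rewrite ltnS.
rewrite /partfun pfun_sum ?size_id_word //; last by rewrite size_map size_enum_ord.
rewrite sum_SSLT_anchors mulr_sumr.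
rewrite (reindex_onto (enc m.+1) (@dec _ al m.+1)) /=; last first.
  by move=> h ch; apply: enc_dec.
apply: eq_big => [a|a /andP[ch /eqP e]]; last first.
  by apply: hweight_enc; rewrite -e; apply: dec_valid.
apply/andP/idP=> [[ch /eqP <-]|val_a]; first exact: dec_valid.
by rewrite dec_enc // eqxx; split=> //; apply: chain_enc.
Qed.

End Weights.

(** * Cancelling the basement factor *)

Section SymmetricFactor.
Local Open Scope ring_scope.
Variable n : nat.
Local Notation Zpoly := {mpoly {poly int}[n]}.

Lemma prod_varsE : \prod_k 'X_k = 'X_[[multinom 1%N | k < n]] :> Zpoly.
Proof. by rewrite mpolyXE_id; apply: eq_bigr => k _; rewrite mnmE expr1. Qed.

Lemma prod_vars_neq0 : \prod_k 'X_k != 0 :> Zpoly.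
Proof.
rewrite prod_varsE; apply/eqP=> /(congr1 (mcoeff [multinom 1%N | k < n]))/eqP.
by rewrite mcoeffX eqxx mcoeff0 oner_eq0.
Qed.

Lemma msym_prod_vars (s : 'S_n) : msym s (\prod_k 'X_k) = \prod_k 'X_k :> Zpoly.
Proof. by rewrite prod_varsE msymX; congr ('X_[_]); apply/mnmP=> k; rewrite !mnmE. Qed.

(** A symmetric factor passes through the numerator of [varpi]; this carries the basement factor
    through the recursion. *)
Lemma varpi_bar_sym i (f g : Zpoly) : msym (simple_refl i) g = g ->
  varpi_bar i (g * f) = g * varpi_bar i f.
Proof.
move=> sg; rewrite /varpi_bar mulrBr; congr (_ - _).
apply: (mulIf (zlo_neq_zhi i)); rewrite varpiP.
transitivity (g * varpi_num i f); last by rewrite -varpiP mulrA.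
rewrite /varpi_num msymM sg.
by rewrite mulrBr !mulrA [g * (zlo i + _)]mulrC [g * (zhi i + _)]mulrC.
Qed.

End SymmetricFactor.

Local Open Scope ring_scope.

(* The atom indexed by the composition w lam is computed from any reduced
   expression s of any shortest u with u lam = w lam. *)
Theorem theorem4p4 (n : nat) (n_ge1 : (1 <= n)%N)
    (lam : 'X_{1..n}) (lam_part : is_partition lam) (w : 'S_n)
    (u : 'S_n) (u_lam : perm_act u lam = perm_act w lam) (u_min : min_length_rep lam u)
    (s : seq 'I_n.-1) (s_red : reduced_word u s) :
  varpi_bar_word s 'X_[lam] =
    \sum_(S in SSLT (perm_act w lam)) beta ^+ excess S *: 'X_[wt S].
Proof.
rewrite -u_lam => {w u_lam n_ge1}.
elim: s u u_min s_red => [|i s IH] u u_min s_red.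
  have /andP[/eqP <- _] := s_red.
  rewrite (_ : perm_act _ lam = lam) /= ?sum_SSLT_partition //.
  by apply/mnmP=> k; rewrite mnmE invg1 perm1.
have e : perm_of_word (i :: s) = u by case/andP: s_red => /eqP.
rewrite -e in u_min s_red *.
have [min' red' lt] := reduced_min_cons lam_part u_min s_red.
rewrite [LHS]/= (IH _ min' red').
set mu := perm_act (perm_of_word s) lam in lt *; set nu := perm_act _ lam.
have nuE : nu =1 mu \o simple_refl i by move=> k; rewrite /nu /= perm_act_simple.
(* One bound serves both shapes, as [mu] and [nu] rearrange [lam]. *)
pose m := \max_k lam k.
have mu_le r : (mu r <= m)%N by rewrite mnmE; apply: leq_bigmax.
have nu_le r : (nu r <= m)%N by rewrite nuE; apply: mu_le.
(* Multiplication by the product of all variables turns both sums into partition functions. *)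
apply: (mulfI (prod_vars_neq0 n)).
rewrite -varpi_bar_sym ?msym_prod_vars // -(partfun_SSLT mu_le) -(partfun_SSLT nu_le).
rewrite -partfun_swap //; apply: eq_pfun; last by rewrite !size_map.
by move=> k; rewrite nuE.
Qed.
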